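(* Let $x,a,b,c$ be non-negative integers and let $B'_{x,a,b,c}$ be the weighted region defined in the context. If $b$ is odd, then \[ \operatorname{M}(B'_{x,a,b,c})=\operatorname{M}(P'_{c,c,a})\frac{\operatorname{V}(2x+2a+b+2,c-1,\lfloor\frac{c+1}{2}\rfloor)}{\operatorname{V}(2a+b+2,c-1,\lfloor\frac{c+1}{2}\rfloor)}\cdot\frac{\operatorname{T}(x+1,2a+b+c-1,b)\,\operatorname{T}(x+a+\frac{b+1}{2},c,\lfloor\frac{c+1}{2}\rfloor)}{\operatorname{T}(1,2a+b+c-1,b)\,\operatorname{T}(a+\frac{b+1}{2},c,\lfloor\frac{c+1}{2}\rfloor)}, \] and if $b$ is even, then \[ \operatorname{M}(B'_{x,a,b,c})=\operatorname{M}(P'_{c,c,a})\frac{\operatorname{V}(2x+2a+b+1,c,\lfloor\frac{c+1}{2}\rfloor)}{\operatorname{V}(2a+b+1,c,\lfloor\frac{c+1}{2}\rfloor)}\cdot\frac{\operatorname{T}(x+1,2a+b+c-1,b)\,\operatorname{T}(x+a+\frac{b+2}{2},c-1,\lfloor\frac{c+1}{2}\rfloor)}{\operatorname{T}(1,2a+b+c-1,b)\,\operatorname{T}(a+\frac{b+2}{2},c-1,\lfloor\frac{c+1}{2}\rfloor)}. \]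
   Context: Notation. For real $x$ and integer $n$: $(x)_n=x(x+1)\cdots(x+n-1)$ if $n>0$, $(x)_0=1$, $(x)_n=1/((x-1)(x-2)\cdots(x+n))$ if $n<0$; $[x]_n=x(x+2)\cdots(x+2(n-1))$ if $n>0$, $[x]_0=1$, $[x]_n=1/((x-2)(x-4)\cdots(x+2n))$ if $n<0$. $\operatorname{T}(x,n,m)=\prod_{i=0}^{m-1}(x+i)_{n-2i}$ if $m>0$, $=1$ if $m=0$, $=\operatorname{T}(x,n,-m)^{-1}$ if $m<0$; $\operatorname{V}(x,n,m)=\prod_{i=0}^{m-1}[x+2i]_{n-2i}$ if $m>0$, $=1$ if $m=0$, $=\operatorname{V}(x,n,-m)^{-1}$ if $m<0$. Lattice and tilings. Regions lie on the triangular lattice drawn with one family of lattice lines horizontal. A lozenge is the union of two unit triangles sharing an edge; a vertical lozenge is one whose two unit triangles share a horizontal edge. If lozenges carry weights, the weight of a tiling is the product of the weights of its lozenges, and $\operatorname{M}(R)$ is the sum of the weights of all lozenge tilings of $R$ (unweighted lozenges have weight $1$). A halved hexagon is a region whose western boundary is a vertical zigzag lattice path (unit segments alternating between the two non-horizontal lattice directions, running downward along a vertical line $\ell$), the other sides being lattice segments: a horizontal northern side, a northeastern side, a southeastern side, a horizontal southern side and possibly a southwestern side. A zigzag step consists of two consecutive unit segments of the zigzag; a removed half-triangle is the part to the right of $\ell$ of a lattice triangle bisected by $\ell$; it is at level $k$ from the top if its horizontal side lies $k$ zigzag steps ($2k$ rows of unit triangles) below the northern side. $P'_{a,b,c}$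 (for $a\le b$): the semi-regular hexagon with side-lengths $a,b,c,a,b,c$ (counterclockwise from the northwestern side) with a maximal staircase cut off (a halved hexagon with zigzag western side), in which each vertical lozenge along the zigzag cut has weight $\frac12$ and all other lozenges weight $1$. (By Ciucu's theorem, $\operatorname{M}(P'_{a,b,c})=2^{-a}\prod_{i=1}^{a}\frac{2c+b-a+i}{c+b-a+i}\prod_{i=1}^{a}[\prod_{j=1}^{b-a+1}\frac{c+i+j-1}{i+j-1}\prod_{j=b-a+2}^{b-a+i}\frac{2c+i+j-1}{i+j-1}]$.) $B'_{x,a,b,c}$: take the halved hexagon whose northern, northeastern, southeastern, southern and southwestern sides have lengths $x+a,\ b+c,\ 2a+c,\ x,\ b+1$ and whose western side is a zigzag lattice path of length $a+c$; give each vertical lozenge along the western side weight $\frac12$; then remove from the western side the right half of a down-pointing triangle of side $2a$, at level $c$ from the top. *)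

(* Defs.v *)
From HB Require Import structures.
From mathcomp Require Import all_boot all_order all_algebra.
From mathcomp Require Import zify.

Set Implicit Arguments.
Unset Strict Implicit.
Unset Printing Implicit Defensive.

Import Order.TTheory GRing.Theory Num.Theory.
Local Open Scope ring_scope.

Section ShiftedFactorials.
Variable R : numFieldType.

(* (x)_n; recall that [Negz k] is the integer -(k+1). *)
Definition poch (x : R) (n : int) : R :=
  match n with
  | Posz k => \prod_(i < k) (x + i%:R)
  | Negz k => (\prod_(i < k.+1) (x - i.+1%:R))^-1
  end.

(* [x]_n *)
Definition poch2 (x : R) (n : int) : R :=
  match n with
  | Posz k => \prod_(i < k) (x + (2 * i)%:R)
  | Negz k => (\prod_(i < k.+1) (x - (2 * i.+1)%:R))^-1
  end.

Definition Tpos (x : R) (n : int) (m : nat) : R :=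
  \prod_(i < m) poch (x + i%:R) (n - (2 * i)%:Z).

Definition T (x : R) (n m : int) : R :=
  match m with
  | Posz k => Tpos x n k
  | Negz k => (Tpos x n k.+1)^-1
  end.

Definition Vpos (x : R) (n : int) (m : nat) : R :=
  \prod_(i < m) poch2 (x + (2 * i)%:R) (n - (2 * i)%:Z).

Definition V (x : R) (n m : int) : R :=
  match m with
  | Posz k => Vpos x n k
  | Negz k => (Vpos x n k.+1)^-1
  end.

End ShiftedFactorials.

(* The plane has coordinates (X, y): X is twice the abscissa, measured from   *)
(* the vertical line l (so l is X = 0, and a horizontal unit segment has      *)
(* X-length 2), and y is the depth below the northern side.  The lattice      *)
(* points are the integer (X, y) with X + y even; in particular the northern  *)
(* end of l is a lattice point.                                               *)
Definition point := (int * int)%type.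

(* The unit triangle (r, k) lies between depths r and r + 1 and is centred at *)
(* X = k.  It points up when r + k is even and down otherwise.  The zigzag    *)
(* (0,0), (-1,1), (0,2), (-1,3), ... has exactly the unit triangles with      *)
(* k >= 0 on its right, those with k = 0 being bisected by l.  Hence letting  *)
(* k range over nat amounts to cutting along this zigzag.                     *)
Definition corners (r k : nat) : seq point :=
  if odd (r + k) then
    [:: (k%:Z, r%:Z + 1); (k%:Z - 1, r%:Z); (k%:Z + 1, r%:Z)]
  else
    [:: (k%:Z, r%:Z); (k%:Z - 1, r%:Z + 1); (k%:Z + 1, r%:Z + 1)].

(* Finite window of unit triangles right of the zigzag: h rows, w columns. *)
Definition tri (h w : nat) := ('I_h * 'I_w)%type.

Section Tilings.
Variables (R : numFieldType) (h w : nat).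
Implicit Types (s t : tri h w) (L D : {set tri h w}).

Definition row_of t : nat := t.1.
Definition col_of t : nat := t.2.

Definition tri_corners t : seq point := corners (row_of t) (col_of t).

(* s points up and t is its mirror image in their common horizontal edge *)
Definition share_horizontal s t : bool :=
  [&& ~~ odd (row_of s + col_of s), row_of t == (row_of s).+1
    & col_of t == col_of s].

Definition share_slanted s t : bool :=
  (row_of t == row_of s) && (col_of t == (col_of s).+1).

Definition lozenge L : bool :=
  [exists s, exists t,
     (L == [set s; t]) && (share_horizontal s t || share_slanted s t)].

(* vertical lozenge whose two triangles are bisected by l *)
Definition zigzag_lozenge L : bool :=
  [exists s, exists t,
     [&& L == [set s; t], share_horizontal s t & col_of s == 0%N]].

Definition lozenge_weight L : R := if zigzag_lozenge L then 2^-1 else 1.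

Definition tiling D (P : {set {set tri h w}}) : bool :=
  partition P D && [forall L in P, lozenge L].

Definition M D : R :=
  \sum_(P : {set {set tri h w}} | tiling D P) \prod_(L in P) lozenge_weight L.

End Tilings.

(* Hexagon with sides a, b, c, a, b, c counterclockwise from the northwestern *)
(* side, whose top left corner is (0, 0); the inequalities are, in order,     *)
(* those of the N and S, NW, SW, NE and SE sides.                             *)
Definition hexagon (a b c : nat) (v : point) : bool :=
  let: (X, y) := v in
  [&& 0 <= y <= (a + b)%:Z, 0 <= X + y, y <= X + (2 * a)%:Z,
      X <= (2 * c)%:Z + y & X + y <= (2 * c + 2 * b)%:Z].

Lemma hexagon_window (a b c r k : nat) :
  all (hexagon a b c) (corners r k) -> (r < a + b)%N && (k < 2 * c + b)%N.
Proof. by rewrite /corners; case: ifP => _ /=; lia. Qed.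

(* Meaningful for a <= b: the zigzag then ends on the SW side. *)
Definition P' (a b c : nat) : {set tri (a + b) (2 * c + b)} :=
  [set t | all (hexagon a b c) (tri_corners t)].

(* The N and S, NE, SE and SW sides of the halved hexagon.  The zigzag has    *)
(* a + c steps and ends at (0, 2(a+c)), where the SW line is met; the last    *)
(* unit segment of the zigzag, from (-1, 2(a+c)-1) to (0, 2(a+c)), is on the  *)
(* SW line, so that this side has length b + 1 when that segment is counted   *)
(* with it.  The southern side has length x.                                  *)
Definition halved_hexagon (x a b c : nat) (v : point) : bool :=
  let: (X, y) := v in
  [&& 0 <= y <= (2 * a + b + 2 * c)%:Z, X <= (2 * (x + a))%:Z + y,
      X + y <= (2 * (x + a) + 2 * (b + c))%:Z & y <= X + (2 * (a + c))%:Z].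

Lemma halved_hexagon_window (x a b c r k : nat) :
  all (halved_hexagon x a b c) (corners r k) ->
  (r < 2 * a + b + 2 * c)%N && (k < 2 * (x + a) + (b + c))%N.
Proof. by rewrite /corners; case: ifP => _ /=; lia. Qed.

(* Down-pointing triangle of side 2a with horizontal side from (-2a, 2c) to   *)
(* (2a, 2c), bisected by l; it reaches down to (0, 2(a+c)).  A unit triangle  *)
(* with k >= 0 overlaps the right half iff it is contained in the triangle.   *)
Definition dent (a c : nat) (v : point) : bool :=
  let: (X, y) := v in
  [&& (2 * c)%:Z <= y, X + y <= (2 * (a + c))%:Z & y <= X + (2 * (a + c))%:Z].

Definition B' (x a b c : nat) :
    {set tri (2 * a + b + 2 * c) (2 * (x + a) + (b + c))} :=
  [set t | all (halved_hexagon x a b c) (tri_corners t)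
           && ~~ all (dent a c) (tri_corners t)].

(* Main.v *)
Require Import Defs.
From mathcomp Require Import all_boot all_order all_fingroup all_algebra.
From mathcomp Require Import zify ring.

Set Implicit Arguments.
Unset Strict Implicit.
Unset Printing Implicit Defensive.

Import Order.TTheory GRing.Theory Num.Theory.
Local Open Scope ring_scope.

(** The lozenges with a horizontal side form non-crossing paths that run down from
    the [x + a] unit edges of the northern side and end in the [a] edges on top of
    the removed triangle and the [x] edges of the southern side.  A region is swept
    row by row.  A path enters a down-pointing triangle through its horizontal edge
    and leaves the row one step to the left or to the right, so expanding [M] along
    that triangle is expanding, by linearity in one row, a determinant with one row
    per path; paths that meet give equal rows.  At the zigzag a path replaces a
    lozenge of weight 1/2, so up to the factor [2 ^- c] each visit to the zigzag
    counts twice, and the entries are numbers of walks on a line folded at [l].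
    [P'] is a halved hexagon without dent, and its determinant is that of [B'] for
    [x = 0].

    Unitriangular row operations turn the entries into binomial coefficients.  After
    division by row factors the columns are [Q f] and [P g] evaluated at
    [m = c, c + 1, ..., c + a + x - 1], where [f] and [g] run through bases of the
    polynomials of degree less than [a] and [x], and [P], [Q] are rising factorials of
    degrees [a + beta] and [x + beta] with [beta = b / 2].  Adding [beta] more points
    and [beta] columns that vanish at the old points, and changing the bases, every
    column becomes a rising factorial [(m + s)_(n - 1)] with [n = a + x + beta]: the
    determinant is a Vandermonde determinant in [s], which runs through three
    arithmetic progressions.  The quotient of its values at [x + 1] and [x] is then
    a quotient of factorials, and so is that of the right-hand sides, where [V] at
    [2 y] is a power of 2 times [T] at [y]. *)

(** * Expansion of [M] along a unit triangle *)

Section LozengeExpansion.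
Variables (R : numFieldType) (h w : nat).
Implicit Types (s t : tri h w) (L D : {set tri h w}) (P : {set {set tri h w}}).

Lemma lozenge_neq0 L : lozenge L -> L != set0.
Proof.
case/existsP=> s /existsP[t /andP[/eqP-> _]].
by apply/set0Pn; exists s; rewrite set21.
Qed.

Lemma tilingD1 D P L : tiling D P -> L \in P -> tiling (D :\: L) (P :\ L).
Proof.
case/andP=> partP /forall_inP lozP LP; apply/andP; split.
  exact: partitionD1.
by apply/forall_inP => B /setD1P[_]; apply: lozP.
Qed.

Lemma tilingU1 D P L :
  lozenge L -> L \subset D -> tiling (D :\: L) P -> tiling D (L |: P).
Proof.
move=> lozL LD /andP[partP /forall_inP lozP]; apply/andP; split.
  rewrite -[D](setID _ L) (setIidPr LD).
  apply: partitionU1 => //; first exact: lozenge_neq0.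
  by rewrite -setI_eq0 setIDA setIC setDIl setDv setI0.
by apply/forall_inP => B /setU1P[->//|]; apply: lozP.
Qed.

Lemma lozenge_notin_tiling D P L :
  lozenge L -> tiling (D :\: L) P -> L \notin P.
Proof.
move=> /lozenge_neq0/set0Pn[t tL] /andP[partP _]; apply/negP=> LP.
by have /subsetP/(_ t tL) := partitionS partP LP; rewrite inE tL.
Qed.

Lemma M_expand_lozenges D t : t \in D ->
  M R D = \sum_(L | [&& lozenge L, L \subset D & t \in L])
            lozenge_weight R L * M R (D :\: L).
Proof.
move=> tD; rewrite /M.
rewrite (partition_big (fun P => pblock P t)
  (fun L => [&& lozenge L, L \subset D & t \in L])) /=; last first.
  move=> P /andP[partP /forall_inP lozP].
  have tP : t \in cover P by rewrite (cover_partition partP).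
  rewrite mem_pblock tP lozP ?pblock_mem // andbT.
  exact: partitionS partP (pblock_mem tP).
apply: eq_bigr => L /and3P[lozL LD tL].
rewrite (reindex_onto (fun P => L |: P) (fun P => P :\ L)) /=; last first.
  move=> P /andP[/andP[partP _] /eqP<-].
  by rewrite setD1K // pblock_mem // (cover_partition partP).
rewrite big_distrr /=; apply: eq_big => [P | P /andP[/andP[_ _] /eqP PL]].
  apply/idP/idP => [/andP[/andP[tilP _] /eqP<-]|tilP].
    by apply: tilingD1 tilP _; rewrite setU11.
  rewrite tilingU1 // setU1K ?(lozenge_notin_tiling lozL tilP) // eqxx andbT /=.
  have /andP[/and3P[_ trivP _] _] := tilingU1 lozL LD tilP.
  by apply/eqP/(def_pblock trivP) => //; rewrite setU11.
by rewrite big_setU1 // -PL setD11.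
Qed.

Definition adjacent s t : bool :=
  [|| share_horizontal s t, share_horizontal t s, share_slanted s t
    | share_slanted t s].

Lemma adjacent_irr t : adjacent t t = false.
Proof. by rewrite /adjacent /share_horizontal /share_slanted; lia. Qed.

Lemma lozenge_memP L t : t \in L ->
  reflect (exists2 s, adjacent t s & L = [set t; s]) (lozenge L).
Proof.
move=> tL; apply: (iffP existsP) => [[s1 /existsP[s2 /andP[/eqP LE sh]]]|].
  rewrite LE in tL; case/set2P: tL => ->.
    by exists s2 => //; case/orP: sh; rewrite /adjacent => ->; rewrite ?orbT.
  exists s1; last by rewrite setUC.
  by case/orP: sh; rewrite /adjacent => ->; rewrite ?orbT.
move=> [s adj ->]; case/or4P: adj => sh.
- by exists t; apply/existsP; exists s; rewrite eqxx sh.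
- by exists s; apply/existsP; exists t; rewrite setUC eqxx sh.
- by exists t; apply/existsP; exists s; rewrite eqxx sh orbT.
- by exists s; apply/existsP; exists t; rewrite setUC eqxx sh orbT.
Qed.

Lemma M_expand D t : t \in D ->
  M R D = \sum_(s in D | adjacent t s)
            lozenge_weight R [set t; s] * M R (D :\: [set t; s]).
Proof.
move=> tD; rewrite (M_expand_lozenges tD).
pose A := [set s in D | adjacent t s].
rewrite [RHS](eq_bigl [in A]) => [|s]; last by rewrite !inE.
rewrite -(big_imset (h := fun s => [set t; s])
           (fun L => lozenge_weight R L * M R (D :\: L))).
  apply: eq_bigl => L; apply/idP/imsetP => [/and3P[lozL LD tL]|[s]].
    have /(lozenge_memP tL)[s adj LE] := lozL; exists s => //.
    by rewrite inE adj andbT (subsetP LD) // LE set22.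
  rewrite inE => /andP[sD adj] ->; rewrite set21 subUset !sub1set tD sD !andbT.
  by apply/lozenge_memP; [apply: set21 | exists s].
move=> s1 s2; rewrite !inE => /andP[_ adj] _ /setP/(_ s1).
rewrite !inE eqxx orbT => /esym/orP[]/eqP // e.
by rewrite e adjacent_irr in adj.
Qed.

Lemma M_set0 : M R (set0 : {set tri h w}) = 1.
Proof.
rewrite /M (big_pred1 set0) ?big_set0 // => P /=; rewrite /tiling partition_set0.
by apply: andb_idr => /eqP->; apply/forall_inP => B; rewrite inE.
Qed.

Lemma zigzag_lozenge_adjacent s t : adjacent s t ->
  zigzag_lozenge [set s; t] = (row_of s != row_of t) && (col_of s == 0%N).
Proof.
move=> adj; apply/existsP/andP => [[u /existsP[v /and3P[/eqP E sh u0]]]|[rows s0]].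
  have ends z : z \in [set s; t] -> (z == u) || (z == v) by rewrite E !inE.
  have := ends s; have := ends t; rewrite set21 set22 => /(_ isT) et /(_ isT) es.
  move: et es sh u0 adj; rewrite /adjacent /share_horizontal /share_slanted.
  by case/orP=> /eqP-> /orP[] /eqP->; lia.
have [sh|sh] : share_horizontal s t \/ share_horizontal t s.
- move: adj rows; rewrite /adjacent /share_slanted.
  by case/or4P; [left | right | |]; lia.
- by exists s; apply/existsP; exists t; rewrite eqxx sh.
- exists t; apply/existsP; exists s; rewrite setUC eqxx sh.
  by case/and3P: sh => _ _ /eqP<-.
Qed.

End LozengeExpansion.

Definition neighbours (r k : nat) : seq (nat * nat) :=
  (r, k.+1) :: (if k is k'.+1 then [:: (r, k')] else [::])
  ++ (if odd (r + k) then if r is r'.+1 then [:: (r', k)] else [::]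
      else [:: (r.+1, k)]).

Lemma neighbours_uniq r k : uniq (neighbours r k).
Proof.
rewrite /neighbours; case: ifP => _; case: k => [|k]; case: r => [|r] //=.
all: by rewrite !inE !xpair_eqE; lia.
Qed.

Definition fits (h w : nat) (F : nat -> nat -> bool) : Prop :=
  forall r k, F r k -> (r < h)%N && (k < w)%N.

Section Regions.
Variables (R : numFieldType) (h w : nat).
Implicit Types (F : nat -> nat -> bool) (s t : tri h w).

Definition region F : {set tri h w} := [set t | F (row_of t) (col_of t)].

Definition without F (p q : nat * nat) (r k : nat) : bool :=
  [&& F r k, (r, k) != p & (r, k) != q].

Definition position t : nat * nat := (row_of t, col_of t).

Lemma position_inj : injective position.
Proof.
by case=> r k [r' k'] []; rewrite /row_of /col_of /= => /val_inj-> /val_inj->.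
Qed.

Lemma eq_region F1 F2 :
  (forall r k, (r < h)%N -> (k < w)%N -> F1 r k = F2 r k) ->
  region F1 = region F2.
Proof. by move=> e; apply/setP=> t; rewrite !inE e ?ltn_ord. Qed.

Lemma region_without F s t :
  region F :\: [set s; t] = region (without F (position s) (position t)).
Proof.
apply/setP=> u; rewrite !inE /without -/(position u) !(inj_eq position_inj).
by rewrite negb_or andbC andbA.
Qed.

Lemma mem_neighbours s t :
  (position t \in neighbours (row_of s) (col_of s)) = adjacent s t.
Proof.
rewrite /neighbours /adjacent /share_horizontal /share_slanted /position.
move: (row_of s) (col_of s) (row_of t) (col_of t) => r k r' k'.
by case: (boolP (odd (r + k))); case: k => [|k]; case: r => [|r];
  rewrite /= !inE !xpair_eqE; lia.
Qed.

Definition neighbour_weight (p q : nat * nat) : R :=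
  if (p.1 != q.1) && (p.2 == 0%N) then 2^-1 else 1.

Lemma M_region_expand F r k :
  fits h w F -> F r k ->
  M R (region F) =
    \sum_(q <- neighbours r k | F q.1 q.2)
      neighbour_weight (r, k) q * M R (region (without F (r, k) q)).
Proof.
move=> Fhw Frk; have inF p : F p.1 p.2 -> exists t, position t = p.
  by case: p => r' k' /Fhw/andP[r'h k'w]; exists (Ordinal r'h, Ordinal k'w).
have [t tE] := inF (r, k) Frk; case: (tE) => tr tk.
have tF : t \in region F by rewrite inE tr tk.
pose f q := neighbour_weight (r, k) q * M R (region (without F (r, k) q)).
rewrite (M_expand R tF) (eq_bigr (fun s => f (position s))); last first.
  move=> s /andP[_ adj]; rewrite region_without tE /lozenge_weight /f.
  by rewrite zigzag_lozenge_adjacent // /neighbour_weight -tr -tk.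
rewrite -big_filter -(big_map position predT f) -[RHS]big_filter.
apply: perm_big; apply: uniq_perm.
- by rewrite (map_inj_uniq position_inj) filter_uniq // index_enum_uniq.
- by rewrite filter_uniq ?neighbours_uniq.
move=> q; rewrite mem_filter; apply/mapP/andP => [[s]|[Fq]].
  rewrite mem_filter -mem_neighbours tr tk inE => /andP[/andP[sF sN] _] ->.
  by rewrite sF sN.
have [s sE] := inF q Fq; rewrite -sE in Fq * => sN; exists s => //.
by rewrite mem_filter -mem_neighbours tr tk sN mem_index_enum inE Fq.
Qed.

Definition path_weight k : R := if k == 0%N then 2 else 1.

Lemma M_region_expand_up F r k :
  fits h w F -> F r k -> ~~ odd (r + k) -> ~~ F r k.+1 ->
  (forall l, k = l.+1 -> ~~ F r l) ->
  M R (region F) =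
    if F r.+1 k
    then (path_weight k)^-1 * M R (region (without F (r, k) (r.+1, k))) else 0.
Proof.
move=> Fhw Frk up right left; rewrite (M_region_expand Fhw Frk) /neighbours.
rewrite (negbTE up) big_cons (negbTE right) big_cat big_mkcond big1_seq.
  rewrite big_mkcond big_seq1 /neighbour_weight /path_weight /= ltn_eqF //= add0r.
  by case: (F r.+1 k); case: (k == 0%N); rewrite ?invr1.
case: k Frk up right left => [//|k] _ _ _ /(_ k erefl) left q.
by rewrite inE => /eqP-> /=; rewrite (negbTE left).
Qed.

Lemma M_region_expand_down F r k :
  fits h w F -> F r k -> odd (r + k) -> (forall q, r = q.+1 -> ~~ F q k) ->
  M R (region F) =
    ((0 < k)%N && F r k.-1)%:R * M R (region (without F (r, k) (r, k.-1)))
    + (F r k.+1)%:R * M R (region (without F (r, k) (r, k.+1))).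
Proof.
move=> Fhw Frk down above; rewrite (M_region_expand Fhw Frk) /neighbours down.
have weight1 q : neighbour_weight (r, k) (r, q) = 1.
  by rewrite /neighbour_weight eqxx.
rewrite -cat1s !big_cat /= addrCA; congr (_ + _).
  case: k {Frk down above} weight1 => [|k] weight1; first by rewrite big_nil mul0r.
  by rewrite big_mkcond big_seq1 weight1 mul1r mulr_natl mulrb.
rewrite big_mkcond big_seq1 weight1 mul1r mulr_natl mulrb -[RHS]addr0.
congr (_ + _).
case: r Frk down above weight1 => [|r] _ _ above _; first by rewrite big_nil.
by rewrite big_mkcond big_seq1 /= (negbTE (above r erefl)).
Qed.

Lemma M_forced_row F r K :
  fits h w F ->
  (forall k, F r k -> [&& ~~ odd (r + k), (k < K)%N & F r.+1 k]) ->
  2 ^+ F r 0 * M R (region F) =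
  M R (region (fun r' k' =>
    F r' k' && ~~ ((r' == r) || (r' == r.+1) && F r k'))).
Proof.
elim: K F => [|K IH] F Fhw covered.
  have row0 k : F r k = false by apply/negP => /covered/and3P[].
  rewrite row0 mul1r; congr (M R _); apply: eq_region => r' k' _ _.
  have [->|_] := eqVneq r' r; rewrite row0 ?andbF //= andbT //.
have [FK|FK] := boolP (F r K); last first.
  apply: IH => // k Fk; have /and3P[-> kK ->] := covered k Fk.
  by rewrite andbT /= ltn_neqAle -ltnS kK andbT; apply: contraTneq Fk => ->.
have /and3P[up _ below] := covered _ FK.
have noF k : odd (r + k) -> ~~ F r k by move=> odd_k; apply/negP => /covered; lia.
rewrite (M_region_expand_up Fhw FK up); first last.
- by move=> l Kl; apply: noF; lia.
- by apply: noF; lia.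
rewrite below mulrA; have -> : 2 ^+ F r 0 * (path_weight K)^-1 =
    2 ^+ without F (r, K) (r.+1, K) r 0 :> R.
  rewrite /path_weight /without !xpair_eqE eqxx.
  case: K {IH covered up} FK below => [|K] FK below /=.
    by rewrite FK divff ?pnatr_eq0.
  by rewrite invr1 mulr1 andbF andbT.
rewrite IH => [|r' k' /and3P[/Fhw]//|k /and3P[/covered/and3P[up_k kK Fk] nk _]].
  congr (M R _); apply: eq_region => r' k' _ _; rewrite /without !xpair_eqE.
  by have [->|_] := eqVneq k' K; have [->|_] := eqVneq r' r; rewrite ?FK ?eqxx; lia.
by move: nk; rewrite up_k /without !xpair_eqE Fk eqxx /=; lia.
Qed.

End Regions.

(** * Determinants of lists of rows *)

Section RowsDeterminant.
Variables (R : comPzRingType) (n : nat).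
Implicit Types (l : seq 'rV[R]_n) (u v : 'rV[R]_n).

Definition rows_det l : R := \det (\matrix_(i < n) nth 0 l i).

Lemma rows_detD l1 l2 (a b : R) u v : (size l1 < n)%N ->
  rows_det (l1 ++ (a *: u + b *: v) :: l2) =
  a * rows_det (l1 ++ u :: l2) + b * rows_det (l1 ++ v :: l2).
Proof.
move=> lt_n; pose i0 := Ordinal lt_n.
have other x y :
    row' i0 (\matrix_(i < n) nth 0 (l1 ++ x :: l2) i) =
    row' i0 (\matrix_(i < n) nth 0 (l1 ++ y :: l2) i).
  apply/matrixP=> i j; rewrite !mxE !nth_cat.
  have := neq_lift i0 i; rewrite -val_eqE /=; case: ltnP => // le_i ne_i.
  by have -> : (bump (size l1) i - size l1 = (bump (size l1) i - size l1).-1.+1)%N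
    by lia.
apply: (@determinant_multilinear _ _ _ _ _ i0); try exact: other.
by rewrite !rowK !nth_cat ltnn subnn.
Qed.

Lemma rows_det_dup l1 l2 u : (size l1 < n)%N -> u \in l1 ->
  rows_det (l1 ++ u :: l2) = 0.
Proof.
move=> lt_n ul1; have lt_l1 : (index u l1 < size l1)%N by rewrite index_mem.
pose i1 := Ordinal (ltn_trans lt_l1 lt_n); pose i2 := Ordinal lt_n.
apply: (@determinant_alternate _ _ _ i1 i2); first by rewrite -val_eqE ltn_eqF.
by move=> j; rewrite !mxE !nth_cat lt_l1 ltnn subnn nth_index.
Qed.

Lemma rows_det_col0 l (j : 'I_n) : {in l, forall u, u 0 j = 0} -> rows_det l = 0.
Proof.
move=> lj0; rewrite /rows_det (expand_det_col _ j) big1 // => i _; rewrite mxE.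
have [le_i|lt_i] := leqP (size l) i; first by rewrite nth_default // mxE mul0r.
by rewrite lj0 ?mul0r // mem_nth.
Qed.

End RowsDeterminant.

Lemma rows_det_delta (R : comPzRingType) m n
    (f : nat -> 'rV[R]_n) (l : seq 'rV[R]_n) :
  rows_det ([seq row_mx (\row_(i < m) (j == i :> nat)%:R) (f j) | j <- iota 0 m]
            ++ [seq row_mx 0 u | u <- l]) =
  rows_det l.
Proof.
rewrite /rows_det -[RHS]mul1r -[X in X * _](det1 R m).
rewrite -(det_ublock _ (\matrix_(i < m) f i)); congr (\det _).
apply/row_matrixP=> i; rewrite rowK nth_cat size_map size_iota.
case: (split_ordP i) => j ->; rewrite /= ?ltn_ord ?ltnNge ?leq_addr /=.
  rewrite (nth_map 0%N) ?size_iota // nth_iota // -[block_mx _ _ _ _]/(col_mx _ _).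
  rewrite rowKu row_row_mx rowK; congr row_mx.
  by apply/rowP=> k; rewrite !mxE /= add0n -val_eqE.
rewrite addKn -[block_mx _ _ _ _]/(col_mx _ _).
rewrite rowKd row_row_mx row0 rowK.
have [le_j|lt_j] := leqP (size l) j; last by rewrite (nth_map 0).
by rewrite !nth_default ?size_map // row_mx0.
Qed.

Lemma sorted_ltn_cat_cons (s1 s2 : seq nat) p : sorted ltn (s1 ++ p :: s2) ->
  {in s1, forall u, u < p}%N /\ {in s2, forall u, p < u}%N.
Proof.
rewrite (sorted_pairwise ltn_trans) pairwise_cat /= allrel_consr.
by case/and3P=> /andP[/allP s1_lt _] _ /andP[/allP s2_gt _].
Qed.

Lemma sorted_ltn_nudge (s1 s2 : seq nat) p q : sorted ltn (s1 ++ p :: s2) ->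
  (p.-1 <= q <= p.+1)%N -> q \notin s1 -> {in s2, forall u, p.+1 < u}%N ->
  sorted ltn (rcons s1 q ++ s2).
Proof.
move=> sorted12 q_p q_s1 s2_gt; have [s1_lt _] := sorted_ltn_cat_cons sorted12.
have s1_q u : u \in s1 -> (u < q)%N.
  move=> us1; have := s1_lt u us1.
  by have : u != q by [apply: contraNneq q_s1 => <-]; lia.
have q_s2 u : u \in s2 -> (q < u)%N by move=> /s2_gt; lia.
move: sorted12; rewrite cat_rcons !(sorted_pairwise ltn_trans) !pairwise_cat /=.
rewrite !allrel_consr => /and3P[/andP[_ ->] -> /andP[_ ->]]; rewrite !andbT.
by apply/andP; split; apply/allP => u; [apply: s1_q | apply: q_s2].
Qed.

(** * Sweeping a region row by row *)

Definition neighbour_sum (R : numFieldType) n (inside : pred nat)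
    (G : nat -> 'rV[R]_n) k : 'rV[R]_n :=
  (((0 < k)%N && inside k.-1)%:R * path_weight R k.-1) *: G k.-1
  + (inside k.+1)%:R *: G k.+1.

Section Sweep.
Variables (R : numFieldType) (h w : nat).
Variables (F : nat -> nat -> bool) (north : pred nat).

(* What is left of the region [F] when the sweep has reached row [r] and the
   paths cross that row downwards through the edges [T], while those that still
   have to cross it enter it through the edges [U]. *)
Definition half_swept r (T U : seq nat) r' k' : bool :=
  F r' k' && ((r < r')%N
    || (r' == r) && (if odd (r' + k') then k' \in U else k' \notin T)).

(* The horizontal edges at depth [r] that a path can reach from above. *)
Definition edge r k : bool :=
  if r is r'.+1 then F r' k && ~~ odd (r' + k) else north k.

Definition exits r : seq nat := [seq k <- iota 0 w | edge r k && ~~ F r k].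

Definition zigzag_tip r : bool := F r 0 && ~~ odd r.

Definition zigzag_weight r (T : seq nat) : R := 2 ^+ (zigzag_tip r && (0%N \notin T)).

(* [e] counts the bisected up-pointing triangles below depth [r]: each of them
   contributes 1/2 unless a path visits it. *)
Definition determinantal r n e (G : nat -> 'rV[R]_n) : Prop :=
  forall T, sorted ltn T -> all (edge r) T -> size T = n ->
  2 ^+ e * ((all [in T] (exits r))%:R * M R (region h w (half_swept r [::] T)))
  = rows_det [seq G k | k <- T].

Hypothesis F_fits : fits h w F.
Hypothesis F_edge : forall r k, F r k -> odd (r + k) -> edge r k.

Lemma half_swept_fits r T U : fits h w (half_swept r T U).
Proof. by move=> r' k' /andP[/F_fits]. Qed.

Lemma M_half_swept_cons r T p U : F r p -> odd (r + p) -> p \notin U ->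
  M R (region h w (half_swept r T (p :: U))) =
    [&& (0 < p)%N, F r p.-1 & p.-1 \notin T]%:R
      * M R (region h w (half_swept r (rcons T p.-1) U))
    + (F r p.+1 && (p.+1 \notin T))%:R
      * M R (region h w (half_swept r (rcons T p.+1) U)).
Proof.
move=> Fp down pU.
have Hp : half_swept r T (p :: U) r p.
  by rewrite /half_swept Fp eqxx down mem_head orbT.
have rest q : ~~ odd (r + q) ->
    region h w (without (half_swept r T (p :: U)) (r, p) (r, q)) =
    region h w (half_swept r (rcons T q) U).
  move=> up; apply: eq_region => r' k' _ _.
  rewrite /without /half_swept !xpair_eqE mem_rcons !inE.
  have [->|_] := eqVneq r' r; last by case: (F r' k'); lia.
  have [->|ne_p] := eqVneq k' p; first by rewrite down (negbTE pU) ltnn /= !andbF.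
  by case: ifP => odd_k; case: (F r k'); case: (k' \in U); case: (k' \in T); lia.
rewrite (M_region_expand_down R (@half_swept_fits _ _ _) Hp down); last first.
  by move=> q ->; rewrite /half_swept; lia.
rewrite {1 3}/half_swept ltnn eqxx /= addnS /= down /=.
case: p down Fp pU Hp rest => [|p] down Fp pU Hp rest.
  by rewrite !mul0r !add0r rest //; lia.
by rewrite /= ifN ?rest //; lia.
Qed.

Lemma half_swept_row r T k :
  half_swept r T [::] r k = edge r.+1 k && (k \notin T).
Proof.
rewrite /half_swept ltnn eqxx in_nil /=.
by case: (odd _); rewrite ?andbF ?andbT.
Qed.

Lemma M_half_swept_stuck r T k : k \in exits r.+1 -> k \notin T ->
  M R (region h w (half_swept r T [::])) = 0.
Proof.
rewrite mem_filter => /andP[/andP[k_edge kF] _] kT; have /andP[Fk up] := k_edge.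
rewrite (@M_region_expand_up _ _ _ _ r k (@half_swept_fits _ _ _)) //.
- by rewrite /half_swept (negbTE kF).
- by rewrite half_swept_row k_edge.
- by rewrite half_swept_row /=; lia.
- by move=> l kl; rewrite half_swept_row /=; lia.
Qed.

Lemma M_half_swept_nil r T :
  zigzag_weight r T * M R (region h w (half_swept r T [::])) =
  (all [in T] (exits r.+1))%:R * M R (region h w (half_swept r.+1 [::] T)).
Proof.
have [/allP exitsT|/allPn[k k_exit kT]] := boolP (all _ _); last first.
  by rewrite (M_half_swept_stuck k_exit kT) mul0r mulr0.
have -> : zigzag_weight r T = 2 ^+ half_swept r T [::] r 0.
  by rewrite half_swept_row /= addn0.
rewrite mul1r (M_forced_row _ (@half_swept_fits _ _ _) (K := w)) => [|k].
  congr (M R _); apply: eq_region => r' k' _ _.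
  rewrite half_swept_row {1}/half_swept [RHS]/half_swept in_nil.
  have [->|ne_r] := eqVneq r' r.
    by rewrite /= andbF ltnNge leqnSn ltn_eqF // andbF.
  have [->|ne_rS] := eqVneq r' r.+1; last by case: (F r' k') => //=; lia.
  rewrite ltnSn ltnn /=; case: ifP => [odd_k|_]; last by rewrite !andbF !andbT.
  by have [/F_edge/(_ odd_k)/andP[-> _]|//] := boolP (F r.+1 k'); rewrite /= negbK.
rewrite half_swept_row => /andP[k_edge kT]; have /andP[Fk up] := k_edge.
have /andP[_ kw] := F_fits Fk; rewrite up kw /=.
rewrite /half_swept ltnSn andbT; apply: contraNT kT => kF.
by apply: exitsT; rewrite mem_filter k_edge kF mem_iota.
Qed.

Lemma zigzag_weight_rcons r T k : F r k -> ~~ odd (r + k) -> k \notin T ->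
  zigzag_weight r T = path_weight R k * zigzag_weight r (rcons T k).
Proof.
move=> Fk up kT; rewrite /zigzag_weight /zigzag_tip /path_weight.
rewrite mem_rcons inE negb_or eq_sym.
have [k0|_] := eqVneq k 0%N; last by rewrite mul1r.
by rewrite k0 addn0 in Fk up kT; rewrite Fk up kT mulr1.
Qed.

Section Row.
Variables (r n e : nat) (G G' : nat -> 'rV[R]_n).

Hypothesis next_row : determinantal r.+1 e G'.
Hypothesis G_step : forall k, F r k -> odd (r + k) ->
  G k = neighbour_sum (F r) G' k.

Lemma sweep_partial_row T U : sorted ltn (T ++ U) -> all (edge r.+1) T ->
  all (fun k => F r k && odd (r + k)) U -> (size T + size U)%N = n ->
  2 ^+ e * (zigzag_weight r T * M R (region h w (half_swept r T U))) =
  rows_det ([seq G' k | k <- T] ++ [seq G k | k <- U]).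
Proof.
elim: U T => [|p U IH] T /=.
  rewrite !cats0 addn0 => T_sorted T_edge _ T_size.
  by rewrite M_half_swept_nil next_row.
move=> TpU_sorted T_edge /andP[/andP[Fp p_down] U_down] size_n.
have [T_lt U_gt] := sorted_ltn_cat_cons TpU_sorted.
have {}U_gt : {in U, forall u, p.+1 < u}%N.
  move=> u uU; have /andP[_ u_down] := allP U_down u uU.
  rewrite ltn_neqAle (U_gt u uU) andbT; apply: contraTneq u_down => <-.
  by rewrite addnS /= p_down.
have pred_le : (p.-1 <= p.+1)%N by apply: leqW (leq_pred p).
have size_T : (size [seq G' k | k <- T] < n)%N.
  by rewrite size_map -size_n addnS ltnS leq_addr.
have extend q : (p.-1 <= q <= p.+1)%N -> F r q -> ~~ odd (r + q) -> q \notin T ->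
    2 ^+ e * (zigzag_weight r T * M R (region h w (half_swept r (rcons T q) U)))
    = path_weight R q * rows_det ([seq G' k | k <- T] ++ G' q :: [seq G k | k <- U]).
  move=> q_p Fq up qT; rewrite (zigzag_weight_rcons Fq up qT) -mulrA mulrCA.
  congr (_ * _); rewrite IH ?map_rcons ?cat_rcons //.
  - by rewrite -cat_rcons; apply: sorted_ltn_nudge TpU_sorted _ _ _.
  - by rewrite all_rcons T_edge /= Fq up.
  - by rewrite size_rcons -size_n addnS.
rewrite M_half_swept_cons //; last by apply/negP => /U_gt; rewrite ltnNge leqnSn.
rewrite G_step // rows_detD // !mulrDr; congr (_ + _).
  rewrite andbA; have [/andP[p_gt0 F_pred]|_] :=
    boolP ((0 < p)%N && F r p.-1); last first.
    by rewrite !mul0r !mulr0.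
  have [predT|predT] := boolP (p.-1 \in T).
    by rewrite !mul0r !mulr0 rows_det_dup ?mulr0 // map_f.
  rewrite !mul1r extend ?leqnn ?pred_le //.
  by rewrite -(prednK p_gt0) addnS in p_down.
have [F_succ|_] := boolP (F r p.+1); last by rewrite !mul0r !mulr0.
have succT : p.+1 \notin T by apply/negP => /T_lt; rewrite ltnNge leqnSn.
by rewrite succT !mul1r extend ?mul1r ?pred_le ?leqnn // addnS /= p_down.
Qed.

Theorem sweep_row T : sorted ltn T -> all (fun k => F r k && odd (r + k)) T ->
  size T = n ->
  2 ^+ (e + zigzag_tip r) * M R (region h w (half_swept r [::] T)) =
  rows_det [seq G k | k <- T].
Proof.
move=> T_sorted T_down T_size; rewrite exprD -mulrA.
by rewrite -(@sweep_partial_row [::]) // /zigzag_weight andbT.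
Qed.

Corollary determinantal_row : (forall k, edge r k -> F r k && odd (r + k)) ->
  determinantal r (e + zigzag_tip r) G.
Proof.
move=> inner T T_sorted /allP T_edge T_size.
have -> : all [in T] (exits r).
  by apply/allP => k; rewrite mem_filter => /andP[/andP[/inner/andP[->]]].
by rewrite mul1r sweep_row //; apply/allP => k /T_edge/inner.
Qed.

End Row.

End Sweep.

(** * Folded walks *)

(* Walks of [s] steps on the half-line from [k] to [X], each arrival at [0]
   counting twice: these are the walks on the line folded at [0]. *)
Fixpoint folded (s X k : nat) : nat :=
  if s is s'.+1 then
    ((if k is k'.+1 then (if k' == 0 then 2 else 1) * folded s' X k' else 0)
     + folded s' X k.+1)%N
  else k == X.

Lemma folded_out s X k : (s + k < X)%N || (s + X < k)%N -> folded s X k = 0%N.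
Proof.
by elim: s k => [|s IH] [|k] out /=; rewrite ?IH //; lia.
Qed.

Section FoldedRows.
Variables (R : numFieldType) (n : nat) (X : nat -> nat).

Definition folded_row s k : 'rV[R]_n := \row_(j < n) (folded s (X j) k)%:R.

Lemma folded_row_out s k :
  (forall j, (j < n)%N -> (s + k < X j)%N || (s + X j < k)%N) ->
  folded_row s k = 0.
Proof. by move=> out; apply/rowP=> j; rewrite !mxE folded_out ?out. Qed.

Lemma folded_row_step (inside : pred nat) s k :
  (forall q, (q.+1 == k) || (q == k.+1) -> ~~ inside q -> folded_row s q = 0) ->
  folded_row s.+1 k = neighbour_sum inside (folded_row s) k.
Proof.
move=> out; rewrite /neighbour_sum.
have -> : (inside k.+1)%:R *: folded_row s k.+1 = folded_row s k.+1.
  by case: (boolP (inside _)) => [|/out->]; rewrite ?scale1r ?scaler0 ?eqxx ?orbT.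
case: k out => [|k] out /=.
  by rewrite mul0r scale0r add0r; apply/rowP=> j; rewrite !mxE.
have -> : ((inside k)%:R * path_weight R k) *: folded_row s k =
    path_weight R k *: folded_row s k.
  by case: (boolP (inside k)) => [|/out->]; rewrite ?mul1r ?scaler0 ?eqxx.
apply/rowP=> j; rewrite !mxE natrD natrM /path_weight.
by case: (k == 0%N).
Qed.

End FoldedRows.

(** * The regions [B'] and [P'] *)

Definition odd_edge (j : nat) : nat := (2 * j + 1)%N.

Definition odd_edges (n : nat) : seq nat := [seq odd_edge j | j <- iota 0 n].

Lemma mem_odd_edges n k : (k \in odd_edges n) = odd k && (k < 2 * n)%N.
Proof.
apply/mapP/idP=> [[j]|ok]; first by rewrite mem_iota /odd_edge => ? ->; lia.
by exists k./2; rewrite ?mem_iota /odd_edge; lia.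
Qed.

Lemma sorted_odd_edges n : sorted ltn (odd_edges n).
Proof.
rewrite sorted_map; apply: sub_sorted (iota_ltn_sorted 0 n) => i j.
by rewrite /= /odd_edge; lia.
Qed.

Definition south_edge (b j : nat) : nat := (b + 1 + 2 * j)%N.

Definition south_edges (b n : nat) : seq nat := [seq south_edge b j | j <- iota 0 n].

Lemma mem_south_edges b n k :
  (k \in south_edges b n) = [&& odd (b + k), (b < k)%N & (k <= b + 2 * n)%N].
Proof.
apply/mapP/idP => [[j]|ok]; first by rewrite mem_iota /south_edge => ? ->; lia.
by exists (k - b)./2; rewrite ?mem_iota /south_edge; lia.
Qed.

Lemma sorted_south_edges b n : sorted ltn (south_edges b n).
Proof.
rewrite sorted_map; apply: sub_sorted (iota_ltn_sorted 0 n) => i j.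
by rewrite /= /south_edge; lia.
Qed.

Section HalvedHexagon.
Variables (R : numFieldType) (x a b c : nat).
Let h := (2 * a + b + 2 * c)%N.
Let w := (2 * (x + a) + (b + c))%N.

Definition B_triangle (r k : nat) : bool :=
  [&& (r < 2 * a + b + 2 * c)%N, (k <= 2 * (x + a) + r)%N,
      (k + r < 2 * (x + a + b + c))%N, (r < 2 * (a + c) + k)%N
    & (r < 2 * c)%N || (2 * (a + c) <= r + k)%N].

Definition north_edge (k : nat) : bool := odd k && (k < 2 * (x + a))%N.

Local Notation B_edge := (edge B_triangle north_edge).
Local Notation B_exits := (exits w B_triangle north_edge).
Local Notation B_determinantal := (determinantal h w B_triangle north_edge).

Lemma B'_region : B' x a b c = region h w B_triangle.
Proof.
apply/setP=> t; rewrite !inE /tri_corners /corners /B_triangle.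
have : (row_of t < h)%N by rewrite ltn_ord.
move: (row_of t) (col_of t); rewrite /h => r k.
by case: (boolP (odd (r + k))) => parity /=; lia.
Qed.

Lemma B_triangle_fits : fits h w B_triangle.
Proof. by move=> r k; rewrite /B_triangle /h /w; lia. Qed.

Lemma B_triangle_edge r k : B_triangle r k -> odd (r + k) -> B_edge r k.
Proof. by case: r => [|r]; rewrite /= /B_triangle /north_edge; lia. Qed.

Definition dent_paths r : nat -> 'rV[R]_a := folded_row R a odd_edge (2 * c - r).
Definition south_paths r : nat -> 'rV[R]_x :=
  folded_row R x (south_edge b) (2 * a + b + 2 * c - r).
Definition paths r k : 'rV[R]_(a + x) := row_mx (dent_paths r k) (south_paths r k).

Lemma south_paths_step r k : B_triangle r k -> odd (r + k) ->
  south_paths r k = neighbour_sum (B_triangle r) (south_paths r.+1) k.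
Proof.
move=> Bk down; rewrite /south_paths.
have /and5P[r_lt _ _ _ _] := Bk; rewrite -(subnSK r_lt).
apply: (@folded_row_step _ _ _ (B_triangle r)) => q q_k out.
apply: folded_row_out => j jx; move: Bk out; rewrite /B_triangle /south_edge.
by lia.
Qed.

Lemma dent_paths_step r k : (r < 2 * c)%N -> B_triangle r k -> odd (r + k) ->
  dent_paths r k = neighbour_sum (B_triangle r) (dent_paths r.+1) k.
Proof.
move=> rc Bk down; rewrite /dent_paths -(subnSK rc).
apply: (@folded_row_step _ _ _ (B_triangle r)) => q q_k out.
apply: folded_row_out => j jx; move: Bk out; rewrite /B_triangle /odd_edge.
by lia.
Qed.

Lemma paths_step r k : (r < 2 * c)%N -> B_triangle r k -> odd (r + k) ->
  paths r k = neighbour_sum (B_triangle r) (paths r.+1) k.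
Proof.
move=> rc Bk down; rewrite /paths south_paths_step // dent_paths_step //.
by rewrite /neighbour_sum !scale_row_mx add_row_mx.
Qed.

Lemma zigzag_tip_B r :
  zigzag_tip B_triangle r = (r < 2 * c)%N && ~~ odd r.
Proof. by rewrite /zigzag_tip /B_triangle; lia. Qed.

Lemma B_edge_last k : B_edge h k = (k \in south_edges b x).
Proof.
rewrite mem_south_edges /edge /north_edge /B_triangle /h.
by case: {-2}(2 * a + b + 2 * c)%N (erefl (2 * a + b + 2 * c)%N) => [|r] rh; lia.
Qed.

Lemma determinantal_last : B_determinantal h 0 (south_paths h).
Proof.
move=> T T_sorted /allP T_edge T_size.
have -> : T = south_edges b x.
  apply: (irr_sorted_eq ltn_trans ltnn T_sorted (sorted_south_edges b x)).
  apply: (uniq_min_size (sorted_uniq ltn_trans ltnn T_sorted) _ _).2.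
    by move=> k /T_edge; rewrite B_edge_last.
  by rewrite size_map size_iota T_size.
have -> : all [in south_edges b x] (B_exits h).
  by apply/allP => k; rewrite mem_filter B_edge_last => /andP[/andP[]].
rewrite !mul1r (_ : region _ _ _ = set0) ?M_set0; last first.
  apply/setP=> t; have t_lt : (row_of t < h)%N := ltn_ord _.
  by rewrite !inE /half_swept ltnNge ltnW // ltn_eqF // andbF.
rewrite /rows_det -[LHS](det1 R x); congr (\det _); apply/row_matrixP=> i.
rewrite row1 rowK -map_comp (nth_map 0%N) ?size_iota // nth_iota //.
apply/rowP=> j; rewrite !mxE eqxx subnn -val_eqE /= /south_edge.
by congr (_%:R); lia.
Qed.

Lemma determinantal_south r : (2 * c < r <= h)%N ->
  B_determinantal r 0 (south_paths r).
Proof.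
have [d] := ubnP (h - r); elim: d r => // d IH r hr /andP[cr].
rewrite leq_eqVlt => /orP[/eqP->|rh]; first exact: determinantal_last.
have tip0 : zigzag_tip B_triangle r = false by rewrite zigzag_tip_B; lia.
rewrite -[0%N]/(0 + false)%N -tip0.
apply: (determinantal_row B_triangle_fits B_triangle_edge (IH r.+1 _ _)).
- by lia.
- by lia.
- by move=> k; apply: south_paths_step.
by case: r {IH tip0} hr cr rh => [|r] // _ cr rh k; rewrite /= /B_triangle; lia.
Qed.

Lemma B_edge_dent_level k :
  B_edge (2 * c) k =
  [&& odd k, (k < 2 * (x + a + c))%N & (k <= 2 * (x + a + b))%N].
Proof.
rewrite /edge /B_triangle /north_edge.
by case: {-1}(2 * c)%N (erefl (2 * c)%N) => [|r] rc; lia.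
Qed.

Lemma inner_dent_level k : B_edge (2 * c) k ->
  (2 * c < h)%N -> (2 * a <= k)%N -> B_triangle (2 * c) k.
Proof. by rewrite B_edge_dent_level /B_triangle /h; lia. Qed.

Lemma dent_exits k : k \in odd_edges a -> k \in B_exits (2 * c).
Proof.
rewrite mem_odd_edges mem_filter mem_iota B_edge_dent_level /B_triangle /w.
by lia.
Qed.

Lemma odd_edges_prefix T : sorted ltn T ->
  all (B_edge (2 * c)) T -> {subset odd_edges a <= T} ->
  T = odd_edges a ++ [seq k <- T | (2 * a <= k)%N].
Proof.
move=> T_sorted /allP T_edge dents_T; apply: (irr_sorted_eq ltn_trans ltnn) => //.
  rewrite sorted_pairwise ?pairwise_cat -?sorted_pairwise; try exact: ltn_trans.
  rewrite sorted_odd_edges sorted_filter ?andbT //; last exact: ltn_trans.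
  apply/allrelP => j k; rewrite mem_odd_edges mem_filter => /andP[_ ja] /andP[ak _].
  exact: leq_trans ak.
move=> k; rewrite mem_cat mem_filter mem_odd_edges; apply/idP/idP => [kT|].
  have := T_edge k kT; rewrite kT andbT B_edge_dent_level => /and3P[-> _ _].
  by rewrite ltnNge; case: leqP.
by case/orP=> [|/andP[]//]; rewrite -mem_odd_edges; apply: dents_T.
Qed.

Lemma below_dents S : sorted ltn S -> size S = x ->
  all (fun k => B_edge (2 * c) k && (2 * a <= k)%N) S ->
  (all [in odd_edges a ++ S] (B_exits (2 * c)))%:R
    * M R (region h w (half_swept B_triangle (2 * c) [::] (odd_edges a ++ S))) =
  rows_det [seq south_paths (2 * c) k | k <- S].
Proof.
move=> S_sorted S_size /allP S_edge.
have [hc|hc] := eqVneq h (2 * c)%N.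
  have a0 : a = 0%N by rewrite /h in hc; lia.
  have -> : odd_edges a = [::] by rewrite a0.
  have := determinantal_last S_sorted; rewrite hc mul1r => -> //.
  by apply/allP => k /S_edge/andP[].
have ch : (2 * c < h)%N by rewrite /h in hc *; lia.
have next : B_determinantal (2 * c).+1 0
              (south_paths (2 * c).+1) by apply: determinantal_south; rewrite ltnSn.
have -> : all [in odd_edges a ++ S] (B_exits (2 * c)).
  apply/allP => k; rewrite mem_filter mem_cat mem_odd_edges.
  move=> /andP[/andP[k_edge kB] _].
  have := k_edge; rewrite B_edge_dent_level => /and3P[-> _ _] /=.
  by case: ltnP => //= ak; rewrite inner_dent_level in kB.
have tip0 : zigzag_tip B_triangle (2 * c) = false by rewrite zigzag_tip_B ltnn.
have := sweep_row B_triangle_fits B_triangle_edge next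
          (@south_paths_step (2 * c)%N) S_sorted.
rewrite tip0 !mul1r => <- //.
  congr (M R _); apply: eq_region => r k _ _.
  rewrite /half_swept mem_cat mem_odd_edges.
  have [->|//] := eqVneq r (2 * c)%N; case: (boolP (B_triangle _ _)) => // Bk.
  case: ifP => // odd_k; rewrite (_ : (k < 2 * a)%N = false) ?andbF //.
  by move: Bk; rewrite /B_triangle; lia.
apply/allP => k /S_edge/andP[k_edge ak]; rewrite inner_dent_level //=.
by move: k_edge; rewrite B_edge_dent_level oddD oddM => /and3P[->].
Qed.

Lemma dent_paths_last k :
  dent_paths (2 * c) k = \row_(j < a) (k == odd_edge j :> nat)%:R.
Proof. by apply/rowP=> j; rewrite !mxE subnn. Qed.

Lemma rows_det_dents T :
  rows_det [seq paths (2 * c) k | k <- odd_edges a ++ [seq k <- T | (2 * a <= k)%N]] =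
  rows_det [seq south_paths (2 * c) k | k <- T & (2 * a <= k)%N].
Proof.
rewrite -(rows_det_delta a (south_paths (2 * c) \o odd_edge)).
rewrite map_cat -!map_comp; congr (rows_det (_ ++ _)).
  apply: eq_map => j; rewrite /= /paths dent_paths_last; congr row_mx.
  by apply/rowP=> i; rewrite !mxE /odd_edge; congr (_%:R); lia.
apply/eq_in_map => k; rewrite mem_filter => /andP[ak _].
rewrite /= /paths dent_paths_last; congr row_mx; apply/rowP=> j; rewrite !mxE.
by rewrite gtn_eqF // (leq_trans _ ak) // /odd_edge; have := ltn_ord j; lia.
Qed.

Lemma determinantal_dents : B_determinantal (2 * c) 0 (paths (2 * c)).
Proof.
move=> T T_sorted T_edge T_size; rewrite mul1r.
have [/allP dents_T|/allPn[k k_dent kT]] := boolP (all [in T] (odd_edges a)).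
  have TE := odd_edges_prefix T_sorted T_edge dents_T.
  rewrite {3}TE rows_det_dents {1 2}TE below_dents //.
  - by apply: sorted_filter T_sorted; apply: ltn_trans.
  - by move: T_size; rewrite {1}TE size_cat size_map size_iota => /addnI.
  - by apply/allP => k; rewrite mem_filter => /andP[-> /(allP T_edge)->].
have -> : all [in T] (B_exits (2 * c)) = false.
  by apply/negbTE/allPn; exists k => //; apply: dent_exits.
have [j] := mapP k_dent; rewrite mem_iota => j_lt kE; rewrite mul0r.
apply/esym; apply: (@rows_det_col0 _ _ _ (lshift x (Ordinal j_lt))).
move=> _ /mapP[l lT ->]; rewrite row_mxEl dent_paths_last mxE -kE.
by case: eqP lT kT => // -> ->.
Qed.

Lemma determinantal_paths r : (r <= 2 * c)%N ->
  B_determinantal r (c - uphalf r) (paths r).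
Proof.
have [d] := ubnP (2 * c - r); elim: d r => // d IH r cr.
rewrite leq_eqVlt => /orP[/eqP->|rc].
  have -> : (c - uphalf (2 * c) = 0)%N by lia.
  exact: determinantal_dents.
have eE : (c - uphalf r = c - uphalf r.+1 + zigzag_tip B_triangle r)%N.
  by rewrite zigzag_tip_B rc; lia.
rewrite eE; apply: (determinantal_row B_triangle_fits B_triangle_edge (IH r.+1 _ _)).
- by lia.
- by [].
- by move=> k; apply: paths_step.
by case: r {IH eE} cr rc => [|r] _ rc k; rewrite /= /B_triangle /north_edge; lia.
Qed.

Theorem M_B'_paths :
  2 ^+ c * M R (B' x a b c) = rows_det [seq paths 0 k | k <- odd_edges (a + x)].
Proof.
have north_edgeE k : north_edge k = (k \in odd_edges (a + x)).
  by rewrite mem_odd_edges /north_edge addnC.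
rewrite -(@determinantal_paths 0) ?sorted_odd_edges ?size_map ?size_iota //.
  rewrite subn0; congr (_ * _); rewrite (_ : all _ _) ?mul1r; last first.
    by apply/allP => k; rewrite -north_edgeE mem_filter => /andP[/andP[]].
  rewrite B'_region; congr (M R _); apply: eq_region => r k _ _.
  rewrite /half_swept -north_edgeE; case: (boolP (B_triangle r k)) => //= Bk.
  case: posnP => //= r0; move: Bk; rewrite {}r0 add0n => /B_triangle_edge.
  by case: ifP => // _ /(_ isT); rewrite /edge => ->.
by apply/allP => k; rewrite -north_edgeE.
Qed.

End HalvedHexagon.

(* A halved hexagon without dent whose zigzag ends at its southern side is a [P']. *)
Lemma M_P'_B' (R : numFieldType) a c : M R (P' c c a) = M R (B' a 0 0 c).
Proof.
have -> : P' c c a = region (c + c) (2 * a + c) (B_triangle a 0 0 c).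
  apply/setP=> t; rewrite !inE /tri_corners /corners /B_triangle.
  have : (row_of t < c + c)%N by rewrite ltn_ord.
  move: (row_of t) (col_of t) => r k.
  by case: (boolP (odd (r + k))) => parity /=; lia.
rewrite B'_region (_ : 2 * 0 + 0 + 2 * c = c + c)%N; last by lia.
by rewrite (_ : 2 * (a + 0) + (0 + c) = 2 * a + c)%N //; lia.
Qed.

Lemma eq_rows_det_dim (R : comPzRingType) m n
    (l : seq 'rV[R]_m) (l' : seq 'rV[R]_n) : m = n ->
  (forall i (j : 'I_m) (j' : 'I_n), (i < m)%N -> j = j' :> nat ->
     (nth 0 l i) 0 j = (nth 0 l' i) 0 j') ->
  rows_det l = rows_det l'.
Proof.
move=> mn; case: n / mn l' => l' eq_ll'; congr (\det _).
by apply/matrixP=> i j; rewrite !mxE (eq_ll' i j j).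
Qed.

Theorem M_P'_paths (R : numFieldType) a b c :
  2 ^+ c * M R (P' c c a) =
  rows_det [seq paths R 0 a b c 0 k | k <- odd_edges (a + 0)].
Proof.
rewrite M_P'_B' M_B'_paths; apply: eq_rows_det_dim => [|i j j' ia jj'].
  by rewrite addn0.
rewrite !(nth_map 0%N) ?size_map ?size_iota ?nth_iota ?addn0 //.
have [[]//|k jk] := split_ordP j; have [k' j'k|[]//] := split_ordP j'.
rewrite jk j'k row_mxEr row_mxEl !mxE /south_edge /odd_edge.
by congr (folded _ _ _)%:R; move: jj'; rewrite jk j'k /=; lia.
Qed.

(** * Unfolding the walks *)

Fixpoint walks (s : nat) (d : int) : nat :=
  if s is s'.+1 then (walks s' (d - 1) + walks s' (d + 1))%N else (d == 0).

Lemma walks_out s d : s%:Z < `|d| -> walks s d = 0%N.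
Proof.
elim: s d => [|s IH] d /= lt; first by case: eqP lt => // ->.
by rewrite !IH //; lia.
Qed.

Lemma walks_bin s k : walks s (s%:Z - (2 * k)%:Z) = 'C(s, k).
Proof.
elim: s k => [|s IH] k /=; first by rewrite bin0n; case: k => //= k; lia.
case: k => [|k].
  have -> : s.+1%:Z - (2 * 0)%:Z - 1 = s%:Z - (2 * 0)%:Z by lia.
  by rewrite IH !bin0 walks_out //; lia.
by rewrite binS -!IH; congr (walks _ _ + walks _ _)%N; lia.
Qed.

Lemma walksD m s d :
  walks (m + s) d =
  (\sum_(l < m.+1) 'C(m, l) * walks s (d - m%:Z + (2 * l)%:Z)%R)%N.
Proof.
elim: m d => [|m IH] d /=.
  by rewrite big_ord1 mul1n addr0 subr0.
rewrite !IH [in RHS]big_ord_recl /= bin0 mul1n.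
under [in RHS]eq_bigr => l _ do rewrite /bump /= ?add1n binS mulnDl.
rewrite big_split /= addnA; congr (_ + _)%N; last first.
  by apply: eq_bigr => l _; congr (_ * walks _ _)%N; lia.
rewrite [in LHS]big_ord_recl /= bin0 mul1n; congr (walks _ _ + _)%N; first by lia.
rewrite [in RHS]big_ord_recr /= bin_small // mul0n addn0.
by apply: eq_bigr => l _; rewrite /bump /= ?add1n; congr (_ * walks _ _)%N; lia.
Qed.

Lemma folded_walks s X k :
  folded s X k =
  if k == 0%N then walks s X%:Z
  else (walks s (X%:Z - k%:Z) + walks s (X%:Z + k%:Z))%N.
Proof.
elim: s k => [|s IH] [|k] /=; try by lia.
  by rewrite IH.
rewrite !IH /= (_ : X%:Z - k.+1%:Z - 1 = X%:Z - k.+2%:Z); last by lia.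
rewrite (_ : X%:Z - k.+1%:Z + 1 = X%:Z - k%:Z); last by lia.
rewrite (_ : X%:Z + k.+1%:Z - 1 = X%:Z + k%:Z); last by lia.
rewrite (_ : X%:Z + k.+1%:Z + 1 = X%:Z + k.+2%:Z); last by lia.
case: eqP => [->|_]; last by lia.
by rewrite subr0; lia.
Qed.

Lemma walks_unfold i s X :
  walks ((2 * i).+1 + s) X%:Z =
  (\sum_(t < i.+1) 'C((2 * i).+1, i - t) * folded s X (2 * t + 1))%N.
Proof.
rewrite walksD (_ : (2 * i).+2 = i.+1 + i.+1)%N; last by lia.
rewrite big_split_ord /= (reindex_inj rev_ord_inj) -big_split /=.
apply: eq_bigr => t _; have lt_t := ltn_ord t.
rewrite subSS (_ : 'C(_, i.+1 + t) = 'C((2 * i).+1, i - t)); last first.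
  by rewrite -bin_sub; [congr 'C(_, _) |]; lia.
rewrite -mulnDr folded_walks addn1 /=; congr (_ * _)%N.
by congr (walks _ _ + walks _ _)%N; lia.
Qed.

Section Unfolding.
Variables (R : numFieldType) (n : nat).

Definition unfolding : 'M[R]_n :=
  \matrix_(i, t) (if (t <= i)%N then 'C((2 * i).+1, i - t)%:R else 0).

Lemma det_unfolding : \det unfolding = 1.
Proof.
rewrite det_trig; first by rewrite big1 // => i _; rewrite mxE leqnn subnn bin0.
by apply/is_trig_mxP=> i j ij; rewrite mxE leqNgt ij.
Qed.

Lemma unfolding_folded m (X : nat -> nat) s :
  unfolding *m (\matrix_(t < n) folded_row R m X s (2 * t + 1)) =
  \matrix_(i < n, j < m) (walks ((2 * i).+1 + s) (X j)%:Z)%:R.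
Proof.
apply/matrixP=> i j; rewrite !mxE walks_unfold natr_sum.
rewrite (big_ord_widen n
  (fun t => ('C((2 * i).+1, i - t) * folded s (X j) (2 * t + 1))%N%:R : R)) //.
rewrite [RHS]big_mkcond; apply: eq_bigr => t _; rewrite !mxE ltnS.
by case: ifP => _; rewrite ?mul0r // natrM.
Qed.

End Unfolding.

Lemma rows_det_paths (R : numFieldType) x a b c :
  rows_det [seq paths R x a b c 0 k | k <- odd_edges (a + x)] =
  \det (row_mx
    (\matrix_(i < a + x, j < a)
       (walks ((2 * i).+1 + 2 * c) (odd_edge j)%:Z)%:R)
    (\matrix_(i < a + x, j < x)
       (walks ((2 * i).+1 + (2 * a + b + 2 * c)) (south_edge b j)%:Z)%:R)) :> R.
Proof.
rewrite -!unfolding_folded -mul_mx_row det_mulmx det_unfolding mul1r.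
congr (\det _); apply/row_matrixP=> i; rewrite rowK row_row_mx !rowK.
rewrite (nth_map 0%N) ?size_map ?size_iota // (nth_map 0%N) ?size_iota //.
by rewrite nth_iota // /paths /dent_paths /south_paths !subn0.
Qed.

(** * Rising factorials *)

Section Rising.
Variable R : numFieldType.
Implicit Types (y s : R) (k m n : nat).

Definition rising y n : R := \prod_(i < n) (y + i%:R).

Definition superfact n : R := \prod_(i < n) i`!%:R.

Lemma fact_neq0 k : k`!%:R != 0 :> R.
Proof. by rewrite pnatr_eq0 -lt0n fact_gt0. Qed.

Lemma prod_fact_neq0 n (f : nat -> nat) : \prod_(i < n) (f i)`!%:R != 0 :> R.
Proof. by apply/prodf_neq0 => i _; apply: fact_neq0. Qed.

Lemma superfact_neq0 n : superfact n != 0.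
Proof. exact: (prod_fact_neq0 _ id). Qed.

Lemma superfactS n : superfact n.+1 = superfact n * n`!%:R.
Proof. by rewrite /superfact big_ord_recr. Qed.

Lemma prod_fact_shift m n :
  \prod_(i < n) (m + i)`!%:R = superfact (m + n) / superfact m.
Proof.
by rewrite [X in X / _]/superfact big_split_ord mulrC mulKf ?superfact_neq0.
Qed.

Lemma rising0 y : rising y 0 = 1.
Proof. exact: big_ord0. Qed.

Lemma risingSr y n : rising y n.+1 = rising y n * (y + n%:R).
Proof. by rewrite /rising big_ord_recr. Qed.

Lemma risingS y n : rising y n.+1 = y * rising (y + 1) n.
Proof.
rewrite /rising big_ord_recl addr0; congr (_ * _).
by apply: eq_bigr => i _; rewrite lift0 -nat1r addrA.
Qed.

Lemma risingD y m n : rising y (m + n) = rising y m * rising (y + m%:R) n.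
Proof.
rewrite /rising big_split_ord /=; congr (_ * _).
by apply: eq_bigr => i _; rewrite natrD addrA.
Qed.

Lemma rising_rev y n : \prod_(i < n) (y - i%:R) = rising (y + 1 - n%:R) n.
Proof.
rewrite (reindex_inj rev_ord_inj); apply: eq_bigr => i _ /=.
by rewrite natrB ?ltn_ord // -natr1; ring.
Qed.

Lemma rising_gt0 y n : 0 < y -> 0 < rising y n.
Proof. by move=> y_gt0; apply: prodr_gt0 => i _; rewrite ltr_wpDr. Qed.

Lemma rising_natS_neq0 k n : rising (k%:R + 1) n != 0.
Proof. by rewrite gt_eqF // rising_gt0 // ltr_wpDl. Qed.

Lemma rising_eq0 y k n : y = - k%:R -> (k < n)%N -> rising y n = 0.
Proof. by move=> -> kn; rewrite /rising (bigD1 (Ordinal kn)) //= addNr mul0r. Qed.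

Lemma rising_fact k n : rising (k%:R + 1) n = (k + n)`!%:R / k`!%:R.
Proof.
apply/(canRL (mulfK (fact_neq0 k))); elim: n => [|n IH].
  by rewrite rising0 mul1r addn0.
rewrite risingSr mulrAC IH addnS factS natrM mulrC -natr1 natrD.
by congr (_ * _); ring.
Qed.

Lemma rising1 n : rising 1 n = n`!%:R.
Proof. by have := rising_fact 0 n; rewrite add0r divr1. Qed.

Lemma rising_double y n :
  rising (2 * y) (2 * n) = 2 ^+ (2 * n) * (rising y n * rising (y + 2^-1) n).
Proof.
elim: n => [|n IH]; first by rewrite muln0 !rising0 expr0 !mulr1.
rewrite (_ : 2 * n.+1 = (2 * n).+2)%N; last by lia.
by rewrite !risingSr IH !exprS -(natr1 (2 * n)%N) natrM; field.
Qed.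

Lemma prod_rising_superfact A L :
  \prod_(j < A) rising ((L + j)%:R + 1) (A.-1 - j) =
  ((L + A).-1)`!%:R ^+ A * superfact L / superfact (L + A).
Proof.
rewrite -mulrA -[_ / _]invf_div -prod_fact_shift.
rewrite -[A in _ ^+ A]card_ord -prodr_const -(prodf_div _ predT).
apply: eq_bigr => j _; rewrite rising_fact.
by congr (_`!%:R / _); have := ltn_ord j; lia.
Qed.

(* Newton's forward difference formula: [nu ^_ k] times the second factor is the
   [k]-th difference at [y] of [rising _ nu]. *)
Lemma rising_differences y nu i m : (i < m)%N ->
  rising (y + i%:R) nu =
  \sum_(k < m) 'C(i, k)%:R * ((nu ^_ k)%:R * rising (y + k%:R) (nu - k)).
Proof.
elim: i m y nu => [|i IH] [|m] y nu // lt_m.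
  rewrite big_ord_recl big1 => [|k _]; last by rewrite bin0n mul0r.
  by rewrite bin0 ffactn0 subn0 !mul1r !addr0.
have -> : rising (y + i.+1%:R) nu =
    rising (y + i%:R) nu + nu%:R * rising (y + 1 + i%:R) nu.-1.
  case: nu => [|nu]; first by rewrite !rising0 mul0r addr0.
  rewrite [in RHS]risingS (_ : y + i.+1%:R = y + i%:R + 1); last first.
    by rewrite -natr1 addrA.
  by rewrite risingSr (_ : y + 1 + i%:R = y + i%:R + 1) /= -?natr1; ring.
rewrite (IH m.+1 y nu) 1?ltnW // (IH m (y + 1)) //.
rewrite !big_ord_recl !bin0 -addrA; congr (_ + _).
rewrite big_distrr -big_split /=; apply: eq_bigr => k _.
rewrite /bump /= ?add1n binS natrD mulrDl; congr (_ + _).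
rewrite ffactnS natrM -addrA -nat1r (_ : nu.-1 - k = nu - k.+1)%N; last by lia.
by ring.
Qed.

Definition rising_poly s n : {poly R} := \prod_(i < n) ('X + (s + i%:R)%:P).

Lemma horner_rising_poly s n y : (rising_poly s n).[y] = rising (y + s) n.
Proof.
rewrite /rising_poly horner_prod; apply: eq_bigr => i _.
by rewrite hornerD hornerX hornerC addrA.
Qed.

Lemma monic_rising_poly s n : rising_poly s n \is monic.
Proof. by apply: monic_prod => i _; rewrite monicXaddC. Qed.

Lemma size_rising_poly s n : size (rising_poly s n) = n.+1.
Proof.
rewrite size_prod => [|i _]; last by rewrite -size_poly_eq0 size_XaddC.
rewrite (eq_bigr (fun=> 2%N)) => [|i _]; last by rewrite size_XaddC.
by rewrite sum_nat_const card_ord; lia.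
Qed.

End Rising.

(** * Determinants of Vandermonde type *)

Lemma det_rev_ord (R : comPzRingType) n (A : 'M[R]_n) :
  \det (\matrix_(i, j) A (rev_ord i) (rev_ord j)) = \det A.
Proof.
pose s := perm (@rev_ord_inj n).
have -> : (\matrix_(i, j) A (rev_ord i) (rev_ord j)) = row_perm s (col_perm s A).
  by apply/matrixP=> i j; rewrite !mxE !permE.
rewrite row_permE col_permE !det_mulmx !det_perm odd_permV mulrCA mulrA.
by rewrite -mulrA -signr_addb addbb mulr1.
Qed.

Section Vandermonde.
Variable R : numFieldType.

Definition descending_Vandermonde n (s : 'rV[R]_n) : R :=
  \prod_(i < n) \prod_(j < n | (i < j)%N) (s 0 i - s 0 j).

Local Notation Vdesc := descending_Vandermonde.

Lemma descending_Vandermonde_row m n (s : 'rV[R]_m) (t : 'rV[R]_n) :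
  Vdesc (row_mx s t) =
  Vdesc s * Vdesc t * \prod_(i < m) \prod_(j < n) (s 0 i - t 0 j).
Proof.
rewrite /Vdesc big_split_ord /= mulrAC; congr (_ * _).
  rewrite -big_split /=; apply: eq_bigr => i _; rewrite big_split_ord /=.
  congr (_ * _).
    by apply: eq_bigr => j _; rewrite !row_mxEl.
  apply: eq_big => j; last by rewrite row_mxEl row_mxEr.
  by rewrite (leq_trans (ltn_ord i)) // leq_addr.
apply: eq_bigr => i _; rewrite big_split_ord /= big_pred0 ?mul1r => [|j].
  by apply: eq_big => [j|j _]; rewrite ?ltn_add2l // !row_mxEr.
by apply/negbTE; rewrite -leqNgt (leq_trans (ltnW (ltn_ord j))) // leq_addr.
Qed.

Lemma descending_Vandermonde_arith n (y : R) :
  Vdesc (\row_(j < n) (y - j%:R)) = superfact R n.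
Proof.
rewrite /Vdesc (exchange_big_dep xpredT) //=; apply: eq_bigr => j _.
under eq_bigr => i _ do rewrite !mxE.
rewrite -(big_ord_widen n (fun i => y - i%:R - (y - j%:R))) 1?ltnW //.
under eq_bigr => i _ do rewrite opprB addrC subrKA.
by rewrite rising_rev -rising1; congr rising; ring.
Qed.

Lemma det_monic_polys n (p : 'I_n -> {poly R}) (s : 'rV[R]_n) :
  (forall i, p i \is monic) -> (forall i, size (p i) = i.+1) ->
  \det (\matrix_(i, j) (p i).[s 0 j]) =
  \prod_(i < n) \prod_(j < n | (i < j)%N) (s 0 j - s 0 i).
Proof.
move=> p_monic p_size; rewrite -det_Vandermonde.
pose A : 'M[R]_n := \matrix_(i, k) (p i)`_k.
have -> : \matrix_(i, j) (p i).[s 0 j] = A *m Vandermonde n s.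
  apply/matrixP=> i j; rewrite !mxE (@horner_coef_wide _ n) ?p_size //.
  by apply: eq_bigr => k _; rewrite !mxE.
rewrite det_mulmx (det_trig (_ : is_trig_mx A)).
  rewrite big1 ?mul1r // => i _; rewrite mxE.
  by have /monicP := p_monic i; rewrite /lead_coef p_size.
by apply/is_trig_mxP=> i j ij; rewrite mxE nth_default // p_size.
Qed.

Lemma det_rising_descending n (y : nat -> R) (s : 'rV[R]_n) :
  \det (\matrix_(i < n, j < n) rising (y i + s 0 j) (n.-1 - i)) = Vdesc s.
Proof.
rewrite -det_rev_ord; pose s' : 'rV[R]_n := \row_j s 0 (rev_ord j).
have -> : \matrix_(i, j) (\matrix_(i, j) rising (y i + s 0 j) (n.-1 - i))
              (rev_ord i) (rev_ord j) =
    \matrix_(i < n, j < n) (rising_poly (y (rev_ord i)) i).[s' 0 j].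
  apply/matrixP=> i j; rewrite !mxE horner_rising_poly addrC.
  by congr rising; rewrite /=; have := ltn_ord i; lia.
rewrite det_monic_polys => [|i|i]; rewrite ?monic_rising_poly ?size_rising_poly //.
rewrite [LHS](exchange_big_dep xpredT) //= (reindex_inj rev_ord_inj).
apply: eq_bigr => i _; rewrite (reindex_inj rev_ord_inj).
apply: eq_big => [j|j _] /=; last by rewrite !mxE !rev_ordK.
by have := ltn_ord i; have := ltn_ord j; lia.
Qed.

Lemma det_rising n (y : R) (s : 'rV[R]_n) :
  \det (\matrix_(i < n, j < n) rising (y + i%:R + s 0 j) n.-1) =
  n.-1`!%:R ^+ n / superfact R n * Vdesc s.
Proof.
pose L : 'M[R]_n := \matrix_(i, k) 'C(i, k)%:R.
pose d : 'rV[R]_n := \row_k (n.-1 ^_ k)%:R.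
have -> : \matrix_(i < n, j < n) rising (y + i%:R + s 0 j) n.-1 =
    L *m (diag_mx d *m \matrix_(k, j) rising (y + k%:R + s 0 j) (n.-1 - k)).
  apply/matrixP=> i j; rewrite !mxE addrAC (@rising_differences _ _ _ i n) //.
  by apply: eq_bigr => k _; rewrite mul_diag_mx !mxE (addrAC y).
rewrite !det_mulmx (det_rising_descending (fun k => y + k%:R)) det_diag.
rewrite (det_trig (_ : is_trig_mx L)); last first.
  by apply/is_trig_mxP=> i j ij; rewrite mxE bin_small.
rewrite big1 ?mul1r => [|i _]; last by rewrite mxE binn.
congr (_ * _); rewrite -[n in _ ^+ n]card_ord -prodr_const -(prodf_div _ predT).
rewrite [RHS](reindex_inj rev_ord_inj); apply: eq_bigr => i _ /=; rewrite mxE.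
have -> : (n - i.+1 = n.-1 - i)%N by lia.
have le_i : (i <= n.-1)%N by have := ltn_ord i; lia.
by rewrite -(ffact_fact le_i) natrM mulfK ?fact_neq0.
Qed.

End Vandermonde.

(** * Changing polynomial bases *)

Section PolynomialBlocks.
Variable R : numFieldType.

Definition coef_mx n (f : nat -> {poly R}) : 'M[R]_n := \matrix_(k, j) (f j)`_k.

Definition poly_block m n (P pt : nat -> R) (f : nat -> {poly R}) : 'M[R]_(m, n) :=
  \matrix_(i, j) (P i * (f j).[pt i]).

Lemma poly_block_coef_mx m n P pt (f : nat -> {poly R}) :
  (forall j, (j < n)%N -> size (f j) <= n)%N ->
  poly_block m n P pt f = poly_block m n P pt (fun j => 'X^j) *m coef_mx n f.
Proof.
move=> f_size; apply/matrixP=> i j.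
rewrite !mxE (@horner_coef_wide _ n) ?f_size // big_distrr /=.
by apply: eq_bigr => k _; rewrite !mxE hornerXn; ring.
Qed.

Lemma det_poly_blocks m n P Q pt (f g : nat -> {poly R}) :
  (forall j, (j < m)%N -> size (f j) <= m)%N ->
  (forall j, (j < n)%N -> size (g j) <= n)%N ->
  \det (row_mx (poly_block (m + n) m P pt f) (poly_block (m + n) n Q pt g)) =
  \det (row_mx (poly_block (m + n) m P pt (fun j => 'X^j))
               (poly_block (m + n) n Q pt (fun j => 'X^j)))
  * (\det (coef_mx m f) * \det (coef_mx n g)).
Proof.
move=> f_size g_size; rewrite -(det_ublock (coef_mx m f) 0 (coef_mx n g)) -det_mulmx.
by rewrite mul_row_block !mulmx0 addr0 add0r -!poly_block_coef_mx.
Qed.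

Lemma det_poly_blocks_change m n P Q pt (f f' g g' : nat -> {poly R}) :
  (forall j, (j < m)%N -> size (f j) <= m)%N ->
  (forall j, (j < m)%N -> size (f' j) <= m)%N ->
  (forall j, (j < n)%N -> size (g j) <= n)%N ->
  (forall j, (j < n)%N -> size (g' j) <= n)%N ->
  \det (row_mx (poly_block (m + n) m P pt f) (poly_block (m + n) n Q pt g))
    * (\det (coef_mx m f') * \det (coef_mx n g')) =
  \det (row_mx (poly_block (m + n) m P pt f') (poly_block (m + n) n Q pt g'))
    * (\det (coef_mx m f) * \det (coef_mx n g)).
Proof.
move=> f_size f'_size g_size g'_size.
by rewrite det_poly_blocks // [in RHS]det_poly_blocks // mulrAC.
Qed.

Definition rising_basis (u : R) (v : nat -> R) n j : {poly R} :=
  rising_poly (u - j%:R) j * rising_poly (v j) (n.-1 - j).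

Lemma size_rising_basis u v n j : (j < n)%N -> size (rising_basis u v n j) = n.
Proof.
move=> jn; rewrite size_monicM ?monic_rising_poly //; last first.
  by rewrite -size_poly_eq0 size_rising_poly.
by rewrite !size_rising_poly; lia.
Qed.

Lemma horner_rising_basis u v n j m :
  (rising_basis u v n j).[m] =
  rising (m + (u - j%:R)) j * rising (m + v j) (n.-1 - j).
Proof. by rewrite hornerM !horner_rising_poly. Qed.

(* The values at [1 - u, 2 - u, ...] form a triangular matrix. *)
Lemma det_rising_basis u v n :
  \det (coef_mx n (rising_basis u v n)) =
  \prod_(j < n) rising (1 - u + j%:R + v j) (n.-1 - j).
Proof.
set f := rising_basis u v n; pose pts : 'rV[R]_n := \row_i (1 - u + i%:R).
have VandermondeE : \det (Vandermonde n pts) = superfact R n.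
  rewrite det_Vandermonde -(descending_Vandermonde_arith n (u - 1)).
  apply: eq_bigr => i _; apply: eq_bigr => j _; rewrite !mxE; ring.
apply: (mulfI (superfact_neq0 R n)); rewrite -{1}VandermondeE -det_tr -det_mulmx.
have -> : (Vandermonde n pts)^T *m coef_mx n f =
    \matrix_(i, j) (f j).[1 - u + i%:R].
  apply/matrixP=> i j; rewrite !mxE (@horner_coef_wide _ n) ?size_rising_basis //.
  by apply: eq_bigr => k _; rewrite !mxE mulrC.
rewrite det_trig; last first.
  apply/is_trig_mxP=> i j ij; rewrite mxE horner_rising_basis.
  rewrite (@rising_eq0 _ _ (j - i.+1)%N) ?mul0r //; last by lia.
  by rewrite natrB // -natr1; ring.
rewrite -big_split; apply: eq_bigr => j _; rewrite mxE horner_rising_basis.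
by congr (_ * _); rewrite -rising1; congr rising; ring.
Qed.

Lemma rising_mul_basis (m u : R) n L j : (j < n)%N ->
  rising (m + u) L * (rising_basis u (fun=> u + L%:R) n j).[m] =
  rising (m + (u - j%:R)) (L + n).-1.
Proof.
move=> jn; rewrite horner_rising_basis.
rewrite (_ : (L + n).-1 = j + (L + (n.-1 - j)))%N; last by lia.
rewrite !risingD [in RHS](_ : m + (u - j%:R) + j%:R = m + u); last by ring.
by rewrite (addrA m u L%:R) mulrCA.
Qed.

Lemma poly_block_rising_basis m n L (y u : R) :
  poly_block m n (fun i => rising (y + i%:R + u) L) (fun i => y + i%:R)
             (rising_basis u (fun=> u + L%:R) n) =
  \matrix_(i < m, j < n) rising (y + i%:R + (u - j%:R)) (L + n).-1.
Proof. by apply/matrixP=> i j; rewrite !mxE rising_mul_basis. Qed.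

Lemma det_rising_basis_const n L (u : R) :
  \det (coef_mx n (rising_basis u (fun=> u + L%:R) n)) =
  ((L + n).-1)`!%:R ^+ n * superfact R L / superfact R (L + n).
Proof.
rewrite det_rising_basis -prod_rising_superfact; apply: eq_bigr => j _.
by congr rising; rewrite natrD; ring.
Qed.

End PolynomialBlocks.

Section RisingBlocks.
Variables (R : numFieldType) (a x beta : nat) (y q p : R).
Let n := (a + x + beta)%N.

(* The last [beta] entries make the corresponding rising factorials vanish at
   [y, y + 1, ..., y + (a + x - 1)]. *)
Definition slopes : 'rV[R]_(a + x + beta) :=
  row_mx (row_mx (\row_(j < a) (q - j%:R)) (\row_(j < x) (p - j%:R)))
         (\row_(j < beta) (1 - y - (a + x)%:R - j%:R)).

Lemma slopes_q j : slopes 0 (lshift beta (lshift x j)) = q - j%:R.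
Proof. by rewrite /slopes !row_mxEl mxE. Qed.

Lemma slopes_p j : slopes 0 (lshift beta (rshift a j)) = p - j%:R.
Proof. by rewrite /slopes row_mxEl row_mxEr mxE. Qed.

Lemma slopes_pad j : slopes 0 (rshift (a + x) j) = 1 - y - (a + x)%:R - j%:R.
Proof. by rewrite /slopes row_mxEr mxE. Qed.

Lemma det_rising_blocks :
  \det (row_mx
    (\matrix_(i < a + x, j < a) rising (y + i%:R + (q - j%:R)) n.-1)
    (\matrix_(i < a + x, j < x) rising (y + i%:R + (p - j%:R)) n.-1)) =
  n.-1`!%:R ^+ (a + x) / superfact R n * descending_Vandermonde slopes.
Proof.
have fact_pow_neq0 : n.-1`!%:R ^+ beta != 0 :> R by rewrite expf_neq0 // fact_neq0.
apply: (mulIf fact_pow_neq0).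
transitivity (n.-1`!%:R ^+ n / superfact R n * descending_Vandermonde slopes);
  last by rewrite [in LHS]/n exprD; ring.
rewrite -(det_rising y).
move: slopes_q slopes_p slopes_pad; move: slopes => s s_q s_p s_pad.
set W := (X in _ = \det X); rewrite -[W]submxK.
have -> : ursubmx W = 0.
  apply/matrixP=> i j; rewrite !mxE s_pad /=.
  have := ltn_ord i; have := ltn_ord j => ltj lti.
  apply: (@rising_eq0 _ _ (a + x - i.+1 + j)%N); last by rewrite /n; lia.
  by rewrite (natrD _ (a + x - i.+1)) natrB // -[i.+1%:R]natr1; ring.
rewrite det_lblock; congr (\det _ * _).
  apply/matrixP=> i j; case: (split_ordP j) => k ->.
    by rewrite row_mxEl !mxE s_q.
  by rewrite row_mxEr !mxE s_p.
rewrite det_trig.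
  rewrite (eq_bigr (fun=> n.-1`!%:R)) ?prodr_const ?card_ord // => i _.
  by rewrite !mxE s_pad -rising1 /= natrD; congr rising; ring.
apply/is_trig_mxP=> i j ij; rewrite !mxE s_pad /=.
have := ltn_ord i; have := ltn_ord j => ltj lti.
apply: (@rising_eq0 _ _ (j - i.+1)%N); last by rewrite /n; lia.
by rewrite natrB // !natrD -[i.+1%:R]natr1; ring.
Qed.

Lemma descending_Vandermonde_slopes :
  descending_Vandermonde slopes =
  superfact R a * superfact R x
  * \prod_(j < x) rising (q - p + 1 - a%:R + j%:R) a
  * superfact R beta
  * (\prod_(j < a) rising (q + y + x%:R + j%:R) beta
     * \prod_(j < x) rising (p + y + a%:R + j%:R) beta).
Proof.
rewrite /slopes !descending_Vandermonde_row !descending_Vandermonde_arith.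
rewrite big_split_ord /=; congr (_ * _ * _ * (_ * _)).
- rewrite exchange_big; apply: eq_bigr => j _ /=.
  rewrite (_ : _ + j%:R = q - p + j%:R + 1 - a%:R) -?rising_rev; last by ring.
  by apply: eq_bigr => i _; rewrite !mxE; ring.
- rewrite [RHS](reindex_inj rev_ord_inj); apply: eq_bigr => i _.
  apply: eq_bigr => j _; rewrite row_mxEl !mxE /= natrB ?ltn_ord // -[i.+1%:R]natr1.
  by rewrite natrD; ring.
- rewrite [RHS](reindex_inj rev_ord_inj); apply: eq_bigr => i _.
  apply: eq_bigr => j _; rewrite row_mxEr !mxE /= natrB ?ltn_ord // -[i.+1%:R]natr1.
  by rewrite natrD; ring.
Qed.

Lemma det_rising_poly_blocks (f g : nat -> {poly R}) :
  (forall j, (j < a)%N -> size (f j) <= a)%N ->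
  (forall j, (j < x)%N -> size (g j) <= x)%N ->
  \det (row_mx
    (poly_block (a + x) a (fun i => rising (y + i%:R + q) (x + beta))
                (fun i => y + i%:R) f)
    (poly_block (a + x) x (fun i => rising (y + i%:R + p) (a + beta))
                (fun i => y + i%:R) g)) =
  \det (coef_mx a f) * \det (coef_mx x g)
  * (superfact R n / (superfact R (x + beta) * superfact R (a + beta)))
  * descending_Vandermonde slopes.
Proof.
move=> f_size g_size; set D := \det (row_mx _ _).
have := det_poly_blocks_change (fun i => rising (y + i%:R + q) (x + beta))
  (fun i => rising (y + i%:R + p) (a + beta)) (fun i => y + i%:R) f_size
  (fun j ja => eq_leq (size_rising_basis q (fun=> q + (x + beta)%:R) ja)) g_size
  (fun j jx => eq_leq (size_rising_basis p (fun=> p + (a + beta)%:R) jx)).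
rewrite -/D !poly_block_rising_basis !det_rising_basis_const.
rewrite (_ : x + beta + a = n)%N; last by rewrite /n; lia.
rewrite (_ : a + beta + x = n)%N; last by rewrite /n; lia.
rewrite det_rising_blocks => DE; have fact_n_neq0 := fact_neq0 R n.-1.
pose change : R := n.-1`!%:R ^+ a * superfact R (x + beta) / superfact R n
  * (n.-1`!%:R ^+ x * superfact R (a + beta) / superfact R n).
have change0 : change != 0.
  by rewrite !mulf_neq0 ?invr_eq0 ?expf_neq0 ?superfact_neq0.
apply: (mulIf change0); rewrite DE exprD /change; field.
by rewrite !superfact_neq0.
Qed.

End RisingBlocks.

(** * The determinant in closed form *)

Section WalkPolynomials.
Variable R : numFieldType.

Definition walk_poly s d n : nat -> {poly R} :=
  rising_basis (s%:R + 1) (fun j => (s + d + j + 1)%:R + 1) n.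

Lemma walks_horner s d n m j : (j < n)%N ->
  (walks (2 * (m + s) + d + 1) (d + 1 + 2 * j)%:Z)%:R =
  (2 * (m + s) + d + 1)`!%:R / ((m + s)`!%:R * (m + s + d + n)`!%:R)
  * (walk_poly s d n j).[m%:R] :> R.
Proof.
move=> jn; rewrite horner_rising_basis.
have [le_j|gt_j] := leqP j (m + s); last first.
  rewrite walks_out; last by lia.
  rewrite (@rising_eq0 _ _ (j - (m + s).+1)%N) ?mul0r ?mulr0 //; last by lia.
  by rewrite natrB // -natr1 natrD; ring.
rewrite (_ : (d + 1 + 2 * j)%:Z =
             (2 * (m + s) + d + 1)%:Z - (2 * (m + s - j))%:Z); last by lia.
rewrite (_ : m%:R + (s%:R + 1 - j%:R) = (m + s - j)%:R + 1); last first.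
  by rewrite natrB // natrD; ring.
rewrite (_ : m%:R + ((s + d + j + 1)%:R + 1) = (m + s + d + j + 1)%:R + 1);
  last by rewrite !natrD; ring.
rewrite !rising_fact subnK //.
rewrite (_ : m + s + d + j + 1 + _ = m + s + d + n)%N; last by lia.
have le_bin : (m + s - j <= 2 * (m + s) + d + 1)%N by lia.
rewrite walks_bin -(bin_fact le_bin) !natrM.
rewrite (_ : 2 * (m + s) + d + 1 - (m + s - j) = m + s + d + j + 1)%N; last by lia.
by field; rewrite !fact_neq0.
Qed.

Lemma size_walk_poly s d n j : (j < n)%N -> (size (walk_poly s d n j) <= n)%N.
Proof. by move=> jn; rewrite size_rising_basis. Qed.

Lemma det_walk_poly s d n :
  \det (coef_mx n (walk_poly s d n)) =
  superfact R (d + n + n) / superfact R (d + n) / \prod_(j < n) (2 * j + d + 1)`!%:R.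
Proof.
rewrite det_rising_basis -prod_fact_shift -prodf_div.
apply: eq_bigr => j _; rewrite (_ : _ + _ + _ = (2 * j + d + 1)%:R + 1); last first.
  by rewrite !(natrM, natrD); ring.
by rewrite rising_fact; congr (_`!%:R / _); have := ltn_ord j; lia.
Qed.

End WalkPolynomials.

Section FactorialDuplication.
Variable R : numFieldType.

Lemma fact_double (m k : nat) (eps : bool) :
  (2 * m + eps + 2 * k)`!%:R =
  (2 * m + eps)`!%:R * 2 ^+ (2 * k) * ((m + k)`!%:R / m`!%:R)
  * rising ((m + eps)%:R + 2^-1) k :> R.
Proof.
have -> : (2 * m + eps + 2 * k)`!%:R =
    (2 * m + eps)`!%:R * rising ((2 * m + eps)%:R + 1) (2 * k) :> R.
  by rewrite rising_fact; field; apply: fact_neq0.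
rewrite -rising_fact -!mulrA; congr (_ * _); case: eps => /=.
  rewrite (_ : (2 * m + 1)%:R + 1 = 2 * (m%:R + 1)) ?rising_double; last first.
    by rewrite natrD natrM; ring.
  by congr (_ * (_ * rising _ _)); rewrite natrD; ring.
rewrite (_ : (2 * m + 0)%:R + 1 = 2 * (m%:R + 2^-1)) ?rising_double; last first.
  by rewrite natrD natrM; field.
by congr (_ * _); rewrite mulrC addn0; congr (rising _ _ * _); field.
Qed.

Lemma fact_double_succ (m k : nat) (eps : bool) :
  (2 * m + 1 + (2 * k + eps))`!%:R =
  (2 * m + 1)`!%:R * 2 ^+ (2 * k + eps) * ((m + k + eps)`!%:R / m`!%:R)
  * rising (m%:R + 3 / 2) k :> R.
Proof.
have shift : m%:R + 3 / 2 = (m + true)%:R + 2^-1 :> R by rewrite natrD /=; field.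
rewrite shift; case: eps; last by rewrite !addn0; apply: (fact_double m k true).
rewrite (_ : 2 * m + 1 + (2 * k + true) = (2 * m + true + 2 * k).+1)%N; last by lia.
rewrite (addn1 (m + k)) (addn1 (2 * k)) exprS (factS (m + k)) (factS (_ + 2 * k)).
rewrite 2!natrM fact_double /= -[_.+1%:R]natr1 -[(m + k).+1%:R]natr1 !natrD.
by ring.
Qed.

End FactorialDuplication.

Section BlockFactors.
Variables (R : numFieldType) (x a beta : nat) (eps : bool).
Let b := (2 * beta + eps)%N.
Let q : R := (a + beta + eps)%:R + 1.
Let p : R := 3 / 2.

Definition row_factor (m : nat) : R := (2 * m + 1)`!%:R / (m`!%:R * (m + a)`!%:R).

Definition dent_factor (m : nat) : R := rising (m%:R + q) (x + beta).

Definition south_factor (m : nat) : R := rising (m%:R + p) (a + beta).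

Lemma dent_factor_fact m :
  dent_factor m = (m + a + beta + eps + (x + beta))`!%:R / (m + a + beta + eps)`!%:R.
Proof. by rewrite -rising_fact; congr rising; rewrite /q !natrD; ring. Qed.

Lemma dent_factor_neq0 m : dent_factor m != 0.
Proof. by rewrite dent_factor_fact mulf_neq0 ?invr_eq0 ?fact_neq0. Qed.

Lemma row_factor_south m :
  (2 * (m + a) + b + 1)`!%:R / ((m + a)`!%:R * (m + a + b + x)`!%:R) =
  row_factor m / dent_factor m * (south_factor m * 2 ^+ (2 * a + b)).
Proof.
rewrite /row_factor dent_factor_fact /south_factor /p.
rewrite (_ : 2 * (m + a) + b + 1 = 2 * m + 1 + (2 * (a + beta) + eps))%N; last first.
  by rewrite /b; lia.
rewrite fact_double_succ (_ : 2 * (a + beta) + eps = 2 * a + b)%N; last first.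
  by rewrite /b; lia.
rewrite (_ : m + a + b + x = m + a + beta + eps + (x + beta))%N;
  last by rewrite /b; lia.
by rewrite addnA; field; rewrite !fact_neq0.
Qed.

Variable c : nat.

Theorem rows_det_paths_blocks :
  rows_det [seq paths R x a b c 0 k | k <- odd_edges (a + x)] =
  \prod_(i < a + x) (row_factor (c + i) / dent_factor (c + i))
  * 2 ^+ ((2 * a + b) * x)
  * \det (row_mx
      (poly_block (a + x) a (fun i => rising (c%:R + i%:R + q) (x + beta))
                  (fun i => c%:R + i%:R) (walk_poly R 0 0 a))
      (poly_block (a + x) x (fun i => rising (c%:R + i%:R + p) (a + beta))
                  (fun i => c%:R + i%:R) (walk_poly R a b x))).
Proof.
rewrite rows_det_paths.
pose d : 'rV[R]_(a + x) := \row_i (row_factor (c + i) / dent_factor (c + i)).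
set W := row_mx _ _; set D := row_mx (poly_block _ _ _ _ _) _.
have -> : W = diag_mx d *m (D *m block_mx 1%:M 0 0 (2 ^+ (2 * a + b))%:M).
  rewrite mul_row_block !mulmx0 mulmx1 addr0 add0r mul_mx_row; congr row_mx.
    apply/matrixP=> i j; rewrite mul_diag_mx !mxE -!natrD -/(dent_factor _).
    rewrite (_ : (2 * i).+1 + 2 * c = 2 * (c + i + 0) + 0 + 1)%N; last by lia.
    rewrite (_ : odd_edge j = 0 + 1 + 2 * j)%N; last by rewrite /odd_edge; lia.
    rewrite (walks_horner R _ _ _ (ltn_ord j)) !addn0.
    by rewrite mulrA divfK ?dent_factor_neq0.
  apply/matrixP=> i j; rewrite mul_diag_mx mul_mx_scalar !mxE -!natrD.
  rewrite (_ : (2 * i).+1 + _ = 2 * (c + i + a) + b + 1)%N; last by lia.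
  rewrite (walks_horner R _ _ _ (ltn_ord j)) row_factor_south /south_factor.
  by ring.
rewrite !det_mulmx det_diag det_ublock det1 det_scalar mul1r -exprM mulrA mulrAC.
by congr (_ * _ * _); apply: eq_bigr => i _; rewrite mxE.
Qed.

End BlockFactors.

Definition pair_ratio (R : fieldType) (Y c : nat) : R :=
  (Y + 2 * c + 1)`!%:R * Y`!%:R / ((Y + c + 1)`!%:R * (Y + c)`!%:R).

Definition single_ratio (R : fieldType) (x b d : nat) : R :=
  (x + d + b)`!%:R * x`!%:R / ((x + d)`!%:R * (x + b)`!%:R).

Section ClosedForm.
Variables (R : numFieldType) (a beta c : nat) (eps : bool).
Let b := (2 * beta + eps)%N.
Let q : R := (a + beta + eps)%:R + 1.
Let p : R := 3 / 2.
Let u0 := (c + a + beta + eps)%N.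
Let sf := superfact R.

Definition dent_constant : R :=
  \det (coef_mx a (walk_poly R 0 0 a)) * sf a * sf beta / sf (a + beta).

Definition closed_form x : R :=
  dent_constant
  * \prod_(i < a + x) row_factor R a (c + i) * 2 ^+ ((2 * a + b) * x)
  * (sf (b + x + x) / sf (b + x) / \prod_(j < x) (2 * j + b + 1)`!%:R)
  * (sf (a + x + beta) * sf x / sf (x + beta))
  * (\prod_(j < x) rising ((beta + eps + j)%:R + 2^-1) a
     * \prod_(j < x) rising ((c + a + j)%:R + 3 / 2) beta)
  * (sf (u0 + x) / sf u0 / (sf (u0 + a + x + beta + x) / sf (u0 + a + x + beta))).

Lemma prod_dent_factor x :
  \prod_(i < a + x) dent_factor R x a beta eps (c + i) =
  (sf (u0 + a + x + beta + x) / sf (u0 + x + beta)) / (sf (u0 + a + x) / sf u0).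
Proof.
rewrite (_ : u0 + a + x + beta + x = u0 + x + beta + (a + x))%N; last by lia.
rewrite /sf -(addnA u0 a x) -!prod_fact_shift -prodf_div.
apply: eq_bigr => i _; rewrite dent_factor_fact.
by congr (_`!%:R / _`!%:R); rewrite /u0; lia.
Qed.

Lemma prod_slopes_pad x :
  \prod_(j < a) rising (q + c%:R + x%:R + j%:R) beta =
  (sf (u0 + a + x + beta) / sf (u0 + x + beta)) / (sf (u0 + a + x) / sf (u0 + x)).
Proof.
rewrite (_ : u0 + a + x + beta = u0 + x + beta + a)%N; last by lia.
rewrite (_ : u0 + a + x = u0 + x + a)%N; last by lia.
rewrite /sf -!prod_fact_shift -prodf_div; apply: eq_bigr => j _.
rewrite (_ : _ + j%:R = (u0 + x + j)%:R + 1); last by rewrite /q /u0 !natrD; ring.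
by rewrite rising_fact; congr (_`!%:R / _`!%:R); lia.
Qed.

Theorem rows_det_paths_closed_form x :
  rows_det [seq paths R x a b c 0 k | k <- odd_edges (a + x)] = closed_form x.
Proof.
rewrite rows_det_paths_blocks (det_rising_poly_blocks _ _ _ _
  (@size_walk_poly R 0 0 a) (@size_walk_poly R a b x)).
rewrite descending_Vandermonde_slopes -/q -/p.
have -> : \prod_(j < x) rising (q - p + 1 - a%:R + j%:R) a =
    \prod_(j < x) rising ((beta + eps + j)%:R + 2^-1) a.
  by apply: eq_bigr => j _; congr rising; rewrite /q /p !natrD; field.
have -> : \prod_(j < x) rising (p + c%:R + a%:R + j%:R) beta =
    \prod_(j < x) rising ((c + a + j)%:R + 3 / 2) beta.
  by apply: eq_bigr => j _; congr rising; rewrite /p !natrD; ring.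
rewrite prodf_div prod_dent_factor prod_slopes_pad (det_walk_poly R a b x).
rewrite /closed_form /dent_constant /sf; field.
by rewrite !superfact_neq0 (prod_fact_neq0 _ _ (fun j => 2 * j + b + 1)%N).
Qed.

Definition step_ratio x : R :=
  pair_ratio R (2 * x + 2 * a + b) c * single_ratio R x b (2 * a + c).

Lemma step_ratioE x :
  step_ratio x =
  row_factor R a (c + (a + x)) * 2 ^+ (2 * a + b)
  * ((b + x + x)`!%:R / (b + x)`!%:R)
  * ((a + x + beta)`!%:R * x`!%:R / (x + beta)`!%:R)
  * (rising ((beta + eps + x)%:R + 2^-1) a * rising ((c + a + x)%:R + 3 / 2) beta)
  * ((u0 + x)`!%:R
     / ((u0 + a + x + beta + x)`!%:R * (u0 + a + x + beta + x).+1`!%:R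
        / (u0 + a + x + beta)`!%:R)).
Proof.
rewrite /step_ratio /pair_ratio /single_ratio.
rewrite (_ : 2 * x + 2 * a + b + 2 * c + 1 =
             2 * (c + a + x) + 1 + (2 * beta + eps))%N;
  last by rewrite /b; lia.
rewrite (_ : 2 * x + 2 * a + b = 2 * (x + beta) + eps + 2 * a)%N;
  last by rewrite /b; lia.
rewrite fact_double fact_double_succ /row_factor -/b (exprD 2 (2 * a)) (addnA c a x).
rewrite (_ : x + (2 * a + c) + b = u0 + a + x + beta)%N; last by rewrite /u0 /b; lia.
rewrite (_ : x + (2 * a + c) = c + a + x + a)%N; last by lia.
rewrite (_ : 2 * (x + beta) + eps + 2 * a + c + 1 = (u0 + a + x + beta + x).+1)%N;
  last by rewrite /u0; lia.
rewrite (_ : 2 * (x + beta) + eps + 2 * a + c = u0 + a + x + beta + x)%N;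
  last by rewrite /u0; lia.
rewrite (_ : 2 * (x + beta) + eps = b + x + x)%N; last by rewrite /b; lia.
rewrite (_ : c + a + x + beta + eps = u0 + x)%N; last by rewrite /u0; lia.
rewrite (addnC x b) (addnAC beta).
rewrite (_ : beta + x + eps = x + beta + eps)%N; last by lia.
rewrite (_ : x + beta + a = a + x + beta)%N; last by lia.
by field; rewrite !fact_neq0.
Qed.

Lemma closed_formS x : closed_form x.+1 = closed_form x * step_ratio x.
Proof.
rewrite step_ratioE /closed_form.
rewrite !(addnS, addSn) !big_ord_recr /= /sf !superfactS mulnS exprD.
rewrite (_ : 2 * x + b + 1 = (b + x + x).+1)%N; last by lia.
field; rewrite !fact_neq0 !superfact_neq0.
by rewrite (prod_fact_neq0 _ _ (fun j => 2 * j + b + 1)%N).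
Qed.

End ClosedForm.

(** * The products [T] and [V] *)

Section ProductsTV.
Variable R : numFieldType.
Implicit Types (y : R) (n : int) (k : nat).

Lemma pochS y n : y != 0 -> y + n%:~R != 0 ->
  poch (y + 1) n * y = poch y n * (y + n%:~R).
Proof.
case: n => k y0; first by move=> _; rewrite mulrC -[LHS]risingS -[RHS]risingSr.
rewrite /poch NegzE mulrNz => yn; rewrite big_ord_recl big_ord_recr /=.
have -> : y + 1 - 1%:R = y by ring.
have -> : \prod_(i < k) (y + 1 - (bump 0 i).+1%:R) = \prod_(i < k) (y - i.+1%:R).
  by apply: eq_bigr => i _; rewrite /bump /= add1n -[i.+2%:R]natr1; ring.
by rewrite !invfM mulrAC mulVf // mul1r -mulrA mulVf ?mulr1.
Qed.

Lemma poch_gt0 y n : 0 < y -> 0 < y + n%:~R -> 0 < poch y n.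
Proof.
case: n => k y_gt0; first by move=> _; apply: rising_gt0.
rewrite NegzE mulrNz => yk; rewrite invr_gt0; apply: prodr_gt0 => i _.
by apply: lt_le_trans yk _; rewrite lerB // ler_nat.
Qed.

Lemma poch2_double y n : poch2 (2 * y) n = 2 ^ n * poch y n.
Proof.
have prod_double m (f : nat -> R) :
    \prod_(i < m) (2 * f i) = 2 ^+ m * \prod_(i < m) f i.
  by rewrite big_split /= prodr_const card_ord.
case: n => k /=.
  rewrite -(prod_double k (fun i => y + i%:R)); apply: eq_bigr => i _.
  by rewrite natrM mulrDr.
rewrite -[2 ^ _]/(2 ^+ k.+1)^-1 -invfM.
rewrite -(prod_double k.+1 (fun i => y - i.+1%:R)); congr (_^-1).
by apply: eq_bigr => i _; rewrite natrM mulrBr.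
Qed.

Lemma TposS y n k : (forall i, (i < k)%N -> y + i%:R != 0) ->
  (forall i, (i < k)%N -> y + n%:~R - i%:R != 0) ->
  Tpos (y + 1) n k * rising y k = Tpos y n k * rising (y + n%:~R + 1 - k%:R) k.
Proof.
move=> y0 yn0; rewrite -rising_rev -!big_split /=; apply: eq_bigr => i _.
have yiE : y + i%:R + (n - (2 * i)%:Z)%:~R = y + n%:~R - i%:R.
  by rewrite rmorphB /= -!pmulrn natrM; ring.
by rewrite addrAC pochS ?yiE // ?y0 // yn0.
Qed.

Lemma Tpos_gt0 y n k : 0 < y -> (forall i, (i < k)%N -> 0 < y + n%:~R - i%:R) ->
  0 < Tpos y n k.
Proof.
move=> y_gt0 yn; apply: prodr_gt0 => i _; apply: poch_gt0; first by rewrite ltr_wpDr.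
by rewrite rmorphB /= -!pmulrn (_ : _ + _ = y + n%:~R - i%:R) ?yn // natrM; ring.
Qed.

Lemma Vpos_double y n k :
  Vpos (2 * y) n k = (\prod_(i < k) 2 ^ (n - (2 * i)%:Z)) * Tpos y n k.
Proof.
rewrite -big_split; apply: eq_bigr => i _ /=.
by rewrite natrM -mulrDr poch2_double.
Qed.

Lemma V_div_T y y' n k :
  Vpos (2 * y) n k / Vpos (2 * y') n k = Tpos y n k / Tpos y' n k.
Proof.
rewrite !Vpos_double -mulf_div divff ?mul1r //; apply/prodf_neq0 => i _.
by rewrite expfz_neq0 // pnatr_eq0.
Qed.

Lemma pair_arguments_gt0 (Y c : nat) (w : R) : 2 * w = Y%:R + 1 ->
  [/\ 0 < w,
      forall i, (i < (c.+1)./2)%N -> 0 < w + c%:Z%:~R - i%:R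
    & forall i, (i < (c.+1)./2)%N -> 0 < w + 2^-1 + (c%:Z - 1)%:~R - i%:R].
Proof.
move=> wE; have w_gt0 : 0 < w.
  by rewrite -(pmulr_rgt0 w (ltr0Sn R 1)) wE ltr_wpDl.
split=> // i ik.
  by rewrite -addrA ltr_wpDr // subr_ge0 ler_nat; lia.
rewrite (_ : _ - _ = w + 2^-1 + (c - 1 - i)%:R); last first.
  rewrite !natrB; [|lia..]; rewrite rmorphB /=; ring.
by rewrite !ltr_wpDr // invr_ge0.
Qed.

(* The doubled arguments [2 w] and [2 w + 1] interleave, so that the two rising
   factorials of each kind combine into one quotient of factorials. *)
Lemma Tpos_pair_succ (Y c : nat) (w : R) : 2 * w = Y%:R + 1 ->
  let k := (c.+1)./2 in
  Tpos (w + 1) c%:Z k * Tpos (w + 2^-1 + 1) (c%:Z - 1) k =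
  Tpos w c%:Z k * Tpos (w + 2^-1) (c%:Z - 1) k * pair_ratio R Y c.
Proof.
move=> wE k; have [w_gt0 top1 top2] := pair_arguments_gt0 c wE.
have two0 : 2 != 0 :> R by rewrite pnatr_eq0.
pose v : R := w + c%:Z%:~R + 1 - k%:R.
have bottom : rising w k * rising (w + 2^-1) k =
    (Y + 2 * k)`!%:R / Y`!%:R / 2 ^+ (2 * k).
  apply/(canRL (mulfK (expf_neq0 _ two0))).
  by rewrite mulrC -rising_double wE rising_fact.
have top : rising v k * rising (v - 2^-1) k =
    (Y + 2 * c + 1)`!%:R / (Y + 2 * c + 1 - 2 * k)`!%:R / 2 ^+ (2 * k).
  have v2E : 2 * (v - 2^-1) = (Y + 2 * c + 1 - 2 * k)%:R + 1.
    rewrite natrB; last by rewrite /k; lia.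
    by rewrite /v -pmulrn !(mulrDr, mulrBr) wE !(natrM, natrD); field.
  apply/(canRL (mulfK (expf_neq0 _ two0))).
  rewrite -{1}(subrK 2^-1 v) mulrC [rising _ k * _]mulrC -rising_double v2E.
  by rewrite rising_fact subnK //; rewrite /k; lia.
have factE : (Y + c + 1)`!%:R * (Y + c)`!%:R =
    (Y + 2 * k)`!%:R * (Y + 2 * c + 1 - 2 * k)`!%:R :> R.
  have [kc|kc] : (2 * k = c \/ 2 * k = c.+1)%N by rewrite /k; lia.
    by rewrite mulrC kc; congr (_`!%:R * _`!%:R); lia.
  by rewrite kc; congr (_`!%:R * _`!%:R); lia.
have succ_w : Tpos (w + 1) c k * rising w k = Tpos w c k * rising v k.
  by apply: TposS => i ik; rewrite gt_eqF ?top1 // ltr_wpDr.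
have succ_w_half : Tpos (w + 2^-1 + 1) (c%:Z - 1) k * rising (w + 2^-1) k =
    Tpos (w + 2^-1) (c%:Z - 1) k * rising (v - 2^-1) k.
  rewrite (_ : v - 2^-1 = w + 2^-1 + (c%:Z - 1)%:~R + 1 - k%:R); last first.
    by rewrite /v rmorphB /=; field.
  by apply: TposS => i ik; rewrite gt_eqF ?top2 // !ltr_wpDr ?invr_ge0.
have rising_w_neq0 : rising w k * rising (w + 2^-1) k != 0.
  by rewrite bottom !mulf_neq0 ?invr_eq0 ?expf_neq0 ?fact_neq0.
apply: (mulIf rising_w_neq0); rewrite mulrACA succ_w succ_w_half mulrACA top.
rewrite -[RHS]mulrA bottom /pair_ratio factE; congr (_ * _).
by field; rewrite !fact_neq0 expf_neq0.
Qed.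

Lemma Tpos_pair_gt0 (Y c : nat) (w : R) : 2 * w = Y%:R + 1 ->
  0 < Tpos w c%:Z (c.+1)./2 * Tpos (w + 2^-1) (c%:Z - 1) (c.+1)./2.
Proof.
move=> wE; have [w_gt0 top1 top2] := pair_arguments_gt0 c wE.
by rewrite mulr_gt0 // Tpos_gt0 // ltr_wpDr ?invr_ge0.
Qed.

Lemma nat_argument_gt0 x b d i : (i < b)%N ->
  0 < x%:R + 1 + ((b + d)%:Z - 1)%:~R - i%:R :> R.
Proof.
move=> ib; rewrite (_ : _ - _ = (x + (b + d))%:R - i%:R); last first.
  by rewrite rmorphB /= -pmulrn natrD; ring.
by rewrite subr_gt0 ltr_nat; lia.
Qed.

Lemma Tpos_nat_succ x b d :
  Tpos (x%:R + 1 + 1 : R) ((b + d)%:Z - 1) b =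
  Tpos (x%:R + 1) ((b + d)%:Z - 1) b * single_ratio R x b d.
Proof.
apply: (mulIf (rising_natS_neq0 R x b)); rewrite TposS => [|i ib|i ib]; first last.
- by rewrite gt_eqF // nat_argument_gt0.
- by rewrite gt_eqF // ltr_wpDr // ltr_wpDl.
rewrite (_ : _ - b%:R = (x + d)%:R + 1); last first.
  by rewrite rmorphB /= -pmulrn !natrD; ring.
by rewrite !rising_fact /single_ratio; field; rewrite !fact_neq0.
Qed.

Lemma Tpos_nat_gt0 x b d : 0 < Tpos (x%:R + 1 : R) ((b + d)%:Z - 1) b.
Proof.
by apply: Tpos_gt0 => [|i]; [rewrite ltr_wpDl | apply: nat_argument_gt0].
Qed.

End ProductsTV.

Lemma eq_step_ratio (R : fieldType) (f g r : nat -> R) x :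
  (forall t, f t.+1 = f t * r t) -> (forall t, g t.+1 = g t * r t) ->
  g 0%N != 0 -> f x = f 0%N * (g x / g 0%N).
Proof.
move=> fS gS g0; elim: x => [|x IH]; first by rewrite divff ?mulr1.
by rewrite fS gS IH -mulrA mulrAC.
Qed.

Section Enumeration.
Variables (R : numFieldType) (a b c : nat).

Lemma half_odd : (2 * b./2 + odd b = b)%N.
Proof. by rewrite mul2n addnC odd_double_half. Qed.

(* [V] of a doubled argument is [T] up to a power of [2], whence both parities of
   [b] give this product. *)
Definition T_product (x : nat) : R :=
  Tpos ((x + a)%:R + (b + 1)%:R / 2) c%:Z (c.+1)./2
  * Tpos ((x + a)%:R + (b + 2)%:R / 2) (c%:Z - 1) (c.+1)./2
  * Tpos (x%:R + 1) ((2 * a + b + c)%:Z - 1) b.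

Lemma half_argument x :
  2 * ((x + a)%:R + (b + 1)%:R / 2) = (2 * x + 2 * a + b)%:R + 1 :> R.
Proof. by rewrite !(natrD, natrM); field. Qed.

Lemma half_argument_succ x :
  (x + a)%:R + (b + 2)%:R / 2 = (x + a)%:R + (b + 1)%:R / 2 + 2^-1 :> R.
Proof. by rewrite !natrD; field. Qed.

Lemma T_productS x :
  T_product x.+1 = T_product x * step_ratio R a b./2 c (odd b) x.
Proof.
rewrite /T_product !half_argument_succ (_ : (x.+1 + a)%:R + (b + 1)%:R / 2 =
  (x + a)%:R + (b + 1)%:R / 2 + 1); last by rewrite addSn -natr1; ring.
rewrite -(addrAC _ 2^-1) (Tpos_pair_succ c (half_argument x)) -[x.+1%:R]natr1.
rewrite (_ : (2 * a + b + c)%:Z - 1 = (b + (2 * a + c))%:Z - 1); last by lia.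
rewrite Tpos_nat_succ /step_ratio half_odd; ring.
Qed.

Lemma T_product_gt0 x : 0 < T_product x.
Proof.
rewrite /T_product half_argument_succ.
rewrite mulr_gt0 ?(Tpos_pair_gt0 c (half_argument x)) //.
rewrite (_ : (2 * a + b + c)%:Z - 1 = (b + (2 * a + c))%:Z - 1); last by lia.
exact: Tpos_nat_gt0.
Qed.

Theorem M_B'_T_product x :
  M R (B' x a b c) = M R (P' c c a) * (T_product x / T_product 0).
Proof.
have two0 : 2 ^+ c != 0 :> R by rewrite expf_neq0 // pnatr_eq0.
have detE y : rows_det [seq paths R y a b c 0 k | k <- odd_edges (a + y)] =
    closed_form R a b./2 c (odd b) y.
  by rewrite -[b in LHS]half_odd rows_det_paths_closed_form.
apply: (mulfI two0); rewrite [RHS]mulrA M_B'_paths (M_P'_paths R a b) !detE.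
exact: (eq_step_ratio x (fun t => closed_formS R a b./2 c (odd b) t) T_productS
  (lt0r_neq0 (T_product_gt0 0))).
Qed.

End Enumeration.

Theorem theorem2p4 (R : realFieldType) (x a b c : nat) :
  let f : int := (c.+1)./2%:Z in
  (odd b ->
     M R (B' x a b c) =
       M R (P' c c a)
       * (V ((2 * x + 2 * a + b + 2)%:R : R) (c%:Z - 1) f
          / V ((2 * a + b + 2)%:R : R) (c%:Z - 1) f)
       * ((T ((x + 1)%:R : R) ((2 * a + b + c)%:Z - 1) b%:Z
           * T ((x + a)%:R + (b + 1)%:R / 2 : R) c%:Z f)
          / (T (1 : R) ((2 * a + b + c)%:Z - 1) b%:Z
             * T (a%:R + (b + 1)%:R / 2 : R) c%:Z f)))
  /\
  (~~ odd b ->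
     M R (B' x a b c) =
       M R (P' c c a)
       * (V ((2 * x + 2 * a + b + 1)%:R : R) c%:Z f
          / V ((2 * a + b + 1)%:R : R) c%:Z f)
       * ((T ((x + 1)%:R : R) ((2 * a + b + c)%:Z - 1) b%:Z
           * T ((x + a)%:R + (b + 2)%:R / 2 : R) (c%:Z - 1) f)
          / (T (1 : R) ((2 * a + b + c)%:Z - 1) b%:Z
             * T (a%:R + (b + 2)%:R / 2 : R) (c%:Z - 1) f))).
Proof.
move=> f; have double k :
    (2 * x + 2 * a + b + k)%:R = 2 * ((x + a)%:R + (b + k)%:R / 2) :> R.
  by rewrite !(natrD, natrM); field.
have double0 k : (2 * a + b + k)%:R = 2 * (a%:R + (b + k)%:R / 2) :> R.
  by rewrite !(natrD, natrM); field.
rewrite M_B'_T_product /T_product /V /T /f add0n add0r (natrD R x 1).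
rewrite !double !double0 !V_div_T.
by split=> _; rewrite !invfM; ring.
Qed.
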